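(* Let $n\in\{1,2,\dots\}$ be finite, let $\lambda_1,\dots,\lambda_n$ be distinct real numbers with $\lambda_j>-1/2$, and set $p_j=\lambda_j+\frac12$. Let $B$ be a standard Brownian motion, let $$T_n(B)_t=B_t-\int_0^t ds\int_0^s k_n(s,v)\,dB_v,\qquad k_n(s,v)=\frac1s\sum_{j=1}^n a_{j,n}\Big(\frac vs\Big)^{\lambda_j}\ (0<v\le s),$$ with $a_{j,n}=\dfrac{\prod_{l=1}^n(\lambda_j+\lambda_l+1)}{\prod_{l=1,\,l\ne j}^n(\lambda_j-\lambda_l)}$, and let $\Theta_n(B)_u=e^{-u/2}T_n(B)_{e^u}$ for $u\in\mathbb R$. Let $W$ be the Brownian motion indexed by $\mathbb R$ defined by $$W_u=\begin{cases}B_1+\int_1^{e^u}\frac{dB_s}{\sqrt s}&\text{if }u\ge0,\\ B_1-\int_{e^u}^1\frac{dB_s}{\sqrt s}&\text{if }u\le0.\end{cases}$$ Then $\Theta_n(B)$ has the moving average representation $$\Theta_n(B)_u=\int_{-\infty}^u\eta_n(u-v)\,dW_v,\quad u\in\mathbb R,$$ where $\eta_n$ has the Fourier transform $$\hat\eta_n(\xi)=\frac{1}{1/2-i\xi}\,\Pi_n(\xi),\qquad \Pi_n(\xi)=\prod_{j=1}^n\frac{\xi-ip_j}{\xi+ip_j},\quad \xi\in\mathbb R.$$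
   Context: The Fourier transform convention is $\hat\eta(\xi)=\int e^{i\xi x}\eta(x)\,dx$, where $\eta_n$ is a function on $\mathbb R$ vanishing on $(-\infty,0]$. A Brownian motion indexed by $\mathbb R$ is a centered continuous Gaussian process $(W_u,u\in\mathbb R)$ with independent increments such that $\mathbb E[(W_u-W_v)^2]=|u-v|$ for all $u,v\in\mathbb R$. *)

(* Defs.v *)
From HB Require Import structures.
From mathcomp Require Import all_boot all_order all_algebra.
From mathcomp Require Import all_classical all_reals all_analysis.
From mathcomp Require Import complex.
Set Implicit Arguments.
Unset Strict Implicit.
Unset Printing Implicit Defensive.
Import Order.TTheory GRing.Theory Num.Theory.
Import numFieldNormedType.Exports.
Local Open Scope classical_set_scope.
Local Open Scope ring_scope.

(* [normal_prob 0 0] is not the point mass at 0 in the library, hence the case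
   distinction. *)
Definition centered_gaussian_law {R : realType} (s : R) (A : set R) : \bar R :=
  if s == 0 then \d_(0 : R) A else normal_prob 0 s A.

(* Since [A i := setT] is allowed, the product rule for the whole family gives
   it for every subfamily. *)
Definition mutually_independent d (T : measurableType d) (R : realType)
    (P : probability T R) (n : nat) (Y : 'I_n -> T -> R) : Prop :=
  forall A : 'I_n -> set R, (forall i, measurable (A i)) ->
    P (\bigcap_(i in [set: 'I_n]) (Y i @^-1` A i)) =
    (\prod_(i < n) P (Y i @^-1` A i))%E.

Definition centered_gaussian_process d (T : measurableType d) (R : realType)
    (P : probability T R) (I : set R) (X : R -> {RV P >-> R}) : Prop :=
  forall (n : nat) (t c : 'I_n -> R), (forall i, I (t i)) ->
    exists s : R, forall A : set R, measurable A ->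
      P ((fun w => \sum_(i < n) c i * X (t i) w) @^-1` A) =
      centered_gaussian_law s A.

Definition independent_increments d (T : measurableType d) (R : realType)
    (P : probability T R) (I : set R) (X : R -> {RV P >-> R}) : Prop :=
  forall (n : nat) (t : nat -> R),
    (forall i, (i <= n)%N -> I (t i)) ->
    (forall i, (i < n)%N -> t i <= t i.+1) ->
    mutually_independent P
      (fun (i : 'I_n) (w : T) => X (t i.+1) w - X (t i) w).

(* Nothing is required of [X u] for [u] outside [I]. *)
Definition brownian_motion_on d (T : measurableType d) (R : realType)
    (P : probability T R) (I : set R) (X : R -> {RV P >-> R}) : Prop :=
  [/\ centered_gaussian_process I X,
      independent_increments I X,
      {ae P, forall w, {within I, continuous (fun u => X u w)}} &
      forall u v, I u -> I v ->
        'E_P[fun w => ((X u w - X v w) ^+ 2)%R]%E = `|u - v|%:E].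

Definition standard_brownian_motion d (T : measurableType d) (R : realType)
    (P : probability T R) (B : R -> {RV P >-> R}) : Prop :=
  brownian_motion_on `[0, +oo[ B /\ {ae P, forall w, B 0 w = 0}.

(* The entry [(a, b, c)] encodes the function equal to [c] on [`]a, b]] and to
   0 elsewhere. *)
Definition step_fun {R : realType} (g : seq (R * R * R)) (x : R) : R :=
  \sum_(z <- g) z.2 * \1_(`]z.1.1, z.1.2]) x.

Definition step_integral d (T : measurableType d) (R : realType)
    (P : probability T R) (X : R -> {RV P >-> R}) (g : seq (R * R * R))
    (w : T) : R :=
  \sum_(z <- g) z.2 * (X z.1.2 w - X z.1.1 w).

Definition step_in {R : realType} (J : set R) (g : seq (R * R * R)) : Prop :=
  forall z, z \in g -> z.1.1 <= z.1.2 /\ `]z.1.1, z.1.2] `<=` J.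

(* [Y] is (a version of) the Wiener integral over [J] of the deterministic
   function [f] in L^2(J) against [X]: the L^2(P)-limit of the integrals of
   step functions converging to [f] in L^2(J).  By the Ito isometry it does
   not depend on the approximating sequence, up to a null set, when [X] is a
   Brownian motion. *)
Definition is_wiener_integral d (T : measurableType d) (R : realType)
    (P : probability T R) (X : R -> {RV P >-> R}) (J : set R) (f : R -> R)
    (Y : T -> R) : Prop :=
  [/\ measurable_fun J f, measurable_fun [set: T] Y &
    exists g : nat -> seq (R * R * R),
      [/\ forall k, step_in J (g k),
        (fun k => \int[lebesgue_measure]_(x in J)
            ((f x - step_fun (g k) x) ^+ 2)%R%:E)%E @ \oo --> 0%E &
        (fun k => 'E_P[fun w => ((Y w - step_integral X (g k) w) ^+ 2)%R]%E)
            @ \oo --> 0%E]].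

Definition muntz_coef {R : realType} (n : nat) (lam : 'I_n -> R) (j : 'I_n) : R :=
  (\prod_(l < n) (lam j + lam l + 1)) /
  (\prod_(l < n | l != j) (lam j - lam l)).

Definition muntz_kernel {R : realType} (n : nat) (lam : 'I_n -> R) (s v : R) : R :=
  s^-1 * \sum_(j < n) muntz_coef lam j * (v / s) `^ (lam j).

(* [K] is a jointly measurable version of the process
   s |-> \int_0^s k_n(s, v) dB_v, s > 0, so that it can be integrated in [s]
   path by path. *)
Definition inner_integral_process d (T : measurableType d) (R : realType)
    (P : probability T R) (B : R -> {RV P >-> R}) (n : nat) (lam : 'I_n -> R)
    (K : R -> T -> R) : Prop :=
  measurable_fun [set z : measurableTypeR R * T | (0 : R) < z.1]
    (fun z : measurableTypeR R * T => K z.1 z.2) /\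
  forall s, 0 < s ->
    is_wiener_integral B `]0, s] (muntz_kernel lam s) (K s).

Definition muntz_transform d (T : measurableType d) (R : realType)
    (P : probability T R) (B : R -> {RV P >-> R}) (K : R -> T -> R)
    (t : R) (w : T) : R :=
  B t w - \int[lebesgue_measure]_(s in `]0, t]) K s w.

Definition stationary_transform d (T : measurableType d) (R : realType)
    (P : probability T R) (B : R -> {RV P >-> R}) (K : R -> T -> R)
    (u : R) (w : T) : R :=
  expR (- u / 2) * muntz_transform B K (expR u) w.

Definition lamperti_brownian_motion d (T : measurableType d) (R : realType)
    (P : probability T R) (B W : R -> {RV P >-> R}) : Prop :=
  (forall u, 0 <= u ->
     is_wiener_integral B `]1, expR u] (fun s => (Num.sqrt s)^-1)
       (fun w => W u w - B 1 w)) /\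
  (forall u, u <= 0 ->
     is_wiener_integral B `]expR u, 1] (fun s => (Num.sqrt s)^-1)
       (fun w => B 1 w - W u w)).

(* \int e^{i xi x} f(x) dx for real-valued integrable [f], by real and
   imaginary parts. *)
Definition fourier {R : realType} (f : R -> R) (xi : R) : R[i] :=
  Complex (\int[lebesgue_measure]_x (cos (xi * x) * f x))
          (\int[lebesgue_measure]_x (sin (xi * x) * f x)).

Definition blaschke {R : realType} (n : nat) (p : 'I_n -> R) (xi : R) : R[i] :=
  \prod_(j < n) ((xi -i* p j) / (xi +i* p j))%C.

(* Main.v *)
Require Import Defs.
From HB Require Import structures.
From mathcomp Require Import all_boot all_order all_algebra.
From mathcomp Require Import all_classical all_reals all_analysis.
From mathcomp Require Import measurable_realfun complex ring lra.
Set Implicit Arguments.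
Unset Strict Implicit.
Unset Printing Implicit Defensive.
Import Order.TTheory GRing.Theory Num.Theory.
Import numFieldNormedType.Exports.
Local Open Scope classical_set_scope.
Local Open Scope ring_scope.

(* By polarization, [E (B_u - B_v)^2 = |u - v|] gives the isometry
   [E (int f dB) (int g dB) = int f g] on the half-line.  In it, [B_t] corresponds to
   the indicator of [`]0, t]], the inner integral [K_s] to [k_n(s, .)] on [`]0, s]],
   and [W_b - W_a] to [v^(-1/2)] on [`]e^a, e^b]].  The squared norm of
   [zeta - int_0^t K_s ds] depends only on the inner products of [zeta] and the [K_s],
   by Fubini, so the isometry extends to [T_n(B)_t], which therefore corresponds to
   [1 - int_v^t k_n(s, v) ds = (t / v)^(1/2) phi (ln (t / v))] with
   [phi x = e^(-x/2) (1 - sum_j a_j int_0^x e^(-lam_j y) dy)].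
   Taking [t = e^u], Riemann step functions approximating [phi (u - .)] in the variable
   [r = ln v] converge both in [L^2(dr)] and, after the isometry, to [Theta_n(B)_u].
   Since [phi' = - phi / 2 - sum_j a_j e^(-p_j x)] and [phi 0 = 1], the Fourier transform
   satisfies [(1/2 - i xi) phihat = 1 - sum_j a_j / (p_j - i xi)], which is the partial
   fraction expansion of the Blaschke product. *)

(** * Square-integrable functions *)

(** [K] is only some jointly measurable choice of versions of the inner integrals, and its time
    integral is taken path by path. Exhibiting step integrals that converge to this time integral
    would amount to a stochastic Fubini theorem. Comparing norms avoids it: what must tend to 0 is
    the norm of [zeta - int_0^t K_s ds], where [zeta] is itself a Wiener integral, and this norm
    equals that of the corresponding deterministic difference. The exchanges of integrals have to
    cope with the singularity at [s = 0]: the norm of [K_s] may be of order [s^(-1/2)], which is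
    integrable but not square-integrable. Writing [K_s] as [s^(-1/4)] times [s^(1/4) K_s] leaves two
    square-integrable factors, because [s^(-1/2)] is integrable at 0. The Fourier transform is read
    off a first-order equation and not off a formula for [phi]: the value [lam_j = 0] would
    contribute a separate term [x e^(-x/2)], whereas in the equation every [lam_j] enters through
    the same exponential, of rate [p_j > 0]. *)

Section square_integrable.
Context d (T : measurableType d) (R : realType) (mu : {measure set T -> \bar R}).
Implicit Types f g h : T -> R.

Definition sqint f : Prop :=
  measurable_fun [set: T] f /\
  mu.-integrable [set: T] (EFin \o (fun x => f x ^+ 2)).

Definition inner f g : R := \int[mu]_x (f x * g x).

Lemma sqintP f : measurable_fun [set: T] f ->
  (\int[mu]_x ((f x) ^+ 2)%:E < +oo)%E -> sqint f.
Proof.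
move=> mf lty; split => //; apply/integrableP; split.
  by apply/measurable_EFinP; exact: measurable_funX.
rewrite (eq_integral (fun x => ((f x) ^+ 2)%:E))// => x _ /=.
by rewrite ger0_norm// sqr_ge0.
Qed.

Lemma sqint_measurable f : sqint f -> measurable_fun [set: T] f.
Proof. by case. Qed.

Lemma inner_fin f : sqint f -> (\int[mu]_x ((f x) ^+ 2)%:E)%E = (inner f f)%:E.
Proof.
move=> [mf intf]; rewrite /inner /Rintegral fineK; first by [].
exact: (integrable_fin_num _ intf).
Qed.

Lemma integrable_addr D f g : measurable D -> mu.-integrable D (EFin \o f) ->
  mu.-integrable D (EFin \o g) -> mu.-integrable D (EFin \o (fun x => f x + g x)).
Proof. by move=> mD intf intg; exact: (integrableD mD intf intg). Qed.

Lemma integrable_scaler D c f : measurable D -> mu.-integrable D (EFin \o f) ->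
  mu.-integrable D (EFin \o (fun x => c * f x)).
Proof. by move=> mD intf; exact: (integrableZl mD c intf). Qed.

Lemma sqint_mul f g : sqint f -> sqint g ->
  mu.-integrable [set: T] (EFin \o (fun x => f x * g x)).
Proof.
move=> [mf intf] [mg intg].
apply: (@le_integrable _ _ _ mu _ measurableT _ (EFin \o (fun x => f x ^+ 2 + g x ^+ 2))) => //.
- by apply/measurable_EFinP; exact: measurable_funM.
- move=> x _ /=; rewrite lee_fin [leRHS]ger0_norm ?addr_ge0 ?sqr_ge0//.
  rewrite normrM -(real_normK (num_real (f x))) -(real_normK (num_real (g x))).
  by have := normr_ge0 (f x); have := normr_ge0 (g x); nra.
- exact: integrable_addr.
Qed.

Lemma sqintZ c f : sqint f -> sqint (fun x => c * f x).
Proof.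
move=> [mf intf]; split; first exact: measurable_funM.
rewrite (_ : (fun x => _) = fun x => c ^+ 2 * f x ^+ 2).
  exact: integrable_scaler.
by apply/funext => x; rewrite exprMn.
Qed.

Lemma sqintD f g : sqint f -> sqint g -> sqint (fun x => f x + g x).
Proof.
move=> sf sg; have [mf intf] := sf; have [mg intg] := sg.
split; first exact: measurable_funD.
rewrite (_ : (fun x => _) = fun x => f x ^+ 2 + (f x * g x + f x * g x) + g x ^+ 2).
  by do !apply: integrable_addr => //; exact: sqint_mul.
by apply/funext => x; ring.
Qed.

Lemma sqintB f g : sqint f -> sqint g -> sqint (fun x => f x - g x).
Proof.
move=> sf sg; rewrite (_ : (fun x => _) = (fun x => f x + (-1) * g x)).
  by apply: sqintD => //; exact: sqintZ.
by apply/funext => x; rewrite mulN1r.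
Qed.

Lemma sqint0 : sqint (fun=> 0).
Proof.
split; first exact: measurable_cst.
rewrite (_ : _ \o _ = cst 0%E); first exact: integrable0.
by apply/funext => x /=; rewrite expr0n.
Qed.

Lemma innerC f g : inner f g = inner g f.
Proof. by apply: eq_Rintegral => x _; rewrite mulrC. Qed.

Lemma innerZl c f g : sqint f -> sqint g ->
  inner (fun x => c * f x) g = c * inner f g.
Proof.
move=> sf sg; rewrite /inner -RintegralZl//; last exact: sqint_mul.
by apply: eq_Rintegral => x _; rewrite mulrA.
Qed.

Lemma innerZr c f g : sqint f -> sqint g ->
  inner f (fun x => c * g x) = c * inner f g.
Proof. by move=> sf sg; rewrite innerC innerZl// innerC. Qed.

Lemma innerDl f g h : sqint f -> sqint g -> sqint h ->
  inner (fun x => f x + g x) h = inner f h + inner g h.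
Proof.
move=> sf sg sh; rewrite /inner -RintegralD//; last 2 first.
- exact: sqint_mul.
- exact: sqint_mul.
by apply: eq_Rintegral => x _; rewrite mulrDl.
Qed.

Lemma innerDr f g h : sqint f -> sqint g -> sqint h ->
  inner h (fun x => f x + g x) = inner h f + inner h g.
Proof. by move=> sf sg sh; rewrite innerC innerDl// !(innerC h). Qed.

Lemma innerBl f g h : sqint f -> sqint g -> sqint h ->
  inner (fun x => f x - g x) h = inner f h - inner g h.
Proof.
move=> sf sg sh; rewrite /inner -RintegralB//; last 2 first.
- exact: sqint_mul.
- exact: sqint_mul.
by apply: eq_Rintegral => x _; rewrite mulrBl.
Qed.

Lemma innerBr f g h : sqint f -> sqint g -> sqint h ->
  inner h (fun x => f x - g x) = inner h f - inner h g.
Proof. by move=> sf sg sh; rewrite innerC innerBl// !(innerC h). Qed.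

Lemma inner0l g : inner (fun=> 0) g = 0.
Proof. by rewrite /inner /Rintegral; under eq_integral do rewrite mul0r; rewrite integral0. Qed.

Lemma sqint_sum I (s : seq I) (F : I -> T -> R) :
  (forall i, sqint (F i)) -> sqint (fun x => \sum_(i <- s) F i x).
Proof.
move=> sF; elim: s => [|i s IH].
  by under eq_fun do rewrite big_nil; exact: sqint0.
by under eq_fun do rewrite big_cons; exact: sqintD.
Qed.

Lemma inner_ge0 f : 0 <= inner f f.
Proof. by apply: Rintegral_ge0 => x _; rewrite -expr2 sqr_ge0. Qed.

Lemma inner_sqrB f g : sqint f -> sqint g ->
  inner (fun x => f x - g x) (fun x => f x - g x) =
  inner f f - 2 * inner f g + inner g g.
Proof.
move=> sf sg; have sfg := sqintB sf sg.
rewrite innerBl// !innerBr// (innerC g f); ring.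
Qed.

Lemma inner_CS_sqr f g : sqint f -> sqint g ->
  inner f g ^+ 2 <= inner f f * inner g g.
Proof.
move=> sf sg.
have q (c : R) : 0 <= inner f f - 2 * c * inner f g + c ^+ 2 * inner g g.
  have scg := sqintZ c sg.
  have := inner_ge0 (fun x => f x - c * g x).
  by rewrite inner_sqrB// innerZr// innerZl// innerZr//; congr (0 <= _); ring.
have [g0|g0] := eqVneq (inner g g) 0.
  suff -> : inner f g = 0 by rewrite g0 mulr0 expr0n.
  apply/eqP/contraT => fg0.
  (* When [g] has norm 0 the quadratic is affine in [c]; this [c] gives it the value
     [- inner f f - 2 < 0]. *)
  have := q ((inner f f + 1) / inner f g).
  rewrite g0 mulr0 addr0 -mulrA divfK//.
  by have := inner_ge0 f; lra.
have gpos : 0 < inner g g by rewrite lt_neqAle eq_sym g0 inner_ge0.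
(* The minimizer of the quadratic, that is the coefficient of the projection of [f] on [g]. *)
have := q (inner f g / inner g g).
rewrite (_ : _ - _ + _ = inner f f - inner f g ^+ 2 / inner g g); last by field.
by rewrite subr_ge0 ler_pdivrMr.
Qed.

Lemma inner_CS f g : sqint f -> sqint g ->
  `|inner f g| <= Num.sqrt (inner f f) * Num.sqrt (inner g g).
Proof.
move=> sf sg; rewrite -sqrtrM ?inner_ge0// -sqrtr_sqr ler_wsqrtr//.
exact: inner_CS_sqr.
Qed.

Lemma cvg_inner (f_ g_ : nat -> T -> R) f g :
  (forall k, sqint (f_ k)) -> (forall k, sqint (g_ k)) -> sqint f -> sqint g ->
  (fun k => inner (fun x => f x - f_ k x) (fun x => f x - f_ k x)) @ \oo --> (0 : R) ->
  (fun k => inner (fun x => g x - g_ k x) (fun x => g x - g_ k x)) @ \oo --> (0 : R) ->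
  (fun k => inner (f_ k) (g_ k)) @ \oo --> inner f g.
Proof.
move=> sf_ sg_ sf sg cf cg.
have sfB k := sqintB sf (sf_ k); have sgB k := sqintB sg (sg_ k).
have csf : (fun k => Num.sqrt (inner (fun x => f x - f_ k x) (fun x => f x - f_ k x)))
    @ \oo --> (0 : R).
  by rewrite -[0]sqrtr0; exact: (continuous_cvg _ (@sqrt_continuous R 0)).
have csg : (fun k => Num.sqrt (inner (fun x => g x - g_ k x) (fun x => g x - g_ k x)))
    @ \oo --> (0 : R).
  by rewrite -[0]sqrtr0; exact: (continuous_cvg _ (@sqrt_continuous R 0)).
have c0 (h : nat -> R) (u : nat -> R) : u @ \oo --> (0 : R) ->
    (forall k, `|h k| <= u k) -> h @ \oo --> (0 : R).
  move=> u0 hu; apply/norm_cvg0P.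
  apply: (squeeze_cvgr (f := fun=> 0) (h := u)) => //; last exact: cvg_cst.
  by near=> k; rewrite normr_ge0 hu.
have -> : (fun k => inner (f_ k) (g_ k)) =
    (fun k => inner f g - inner (fun x => f x - f_ k x) g
      - inner f (fun x => g x - g_ k x)
      + inner (fun x => f x - f_ k x) (fun x => g x - g_ k x)).
  apply/funext => k.
  by rewrite [in X in _ + X]innerBl// !innerBr// innerBl//; ring.
rewrite -[X in _ --> X]subr0 -[X in _ --> X]subr0 -[X in _ --> X]addr0.
apply: cvgD; first apply: cvgB; first apply: cvgB; first exact: cvg_cst.
- apply: c0 (fun k => inner_CS (sfB k) sg).
  by rewrite -[X in _ --> X](mul0r (Num.sqrt (inner g g))); exact: cvgMr_tmp.
- apply: c0 (fun k => inner_CS sf (sgB k)).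
  by rewrite -[X in _ --> X](mulr0 (Num.sqrt (inner f f))); exact: cvgMl_tmp.
- apply: c0 (fun k => inner_CS (sfB k) (sgB k)).
  by rewrite -[X in _ --> X](mulr0 0); exact: cvgM.
Unshelve. all: by end_near. Qed.

End square_integrable.

(** * Integrals of families of square-integrable functions *)

Section integrated_family.
Context dS (S : measurableType dS) (R : realType)
  (sig : {sigma_finite_measure set S -> \bar R}).
Context dX (X : measurableType dX) (mu : {sigma_finite_measure set X -> \bar R}).
Variables (k : S -> X -> R) (a : S -> R) (b : S * X -> R).
(** With two square-integrable factors, Cauchy-Schwarz supplies every integrability that Fubini asks
    for, even when the norm of [k s] is not square-integrable in [s]. *)
Hypothesis kE : forall s x, k s x = a s * b (s, x).
Hypothesis sa : sqint sig a.
Hypothesis sb : sqint (sig \x mu)%E b.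

Let mb : measurable_fun [set: S * X] b := sqint_measurable sb.

Definition integrated x : R := \int[sig]_s k s x.

Let measurable_k : measurable_fun [set: S * X] (fun z => k z.1 z.2).
Proof.
rewrite (_ : (fun z => _) = fun z => a z.1 * b z); last first.
  by apply/funext => -[s x]; rewrite kE.
apply: measurable_funM => //.
exact: measurableT_comp (sqint_measurable sa) measurable_fst.
Qed.

(** A section may fail to be integrable at some [x]; treating the positive and negative parts
    separately by Tonelli gives measurability at all [x] nevertheless. *)
Lemma measurable_integrated : measurable_fun [set: X] integrated.
Proof.
rewrite /integrated /Rintegral.
apply: (measurableT_comp (fine_measurable _)) => //.
pose F z := (k z.1 z.2)%:E.
rewrite (_ : (fun x => _) = (fubini_G sig (fun z => F^\+ z) \- fubini_G sig (fun z => F^\- z))%E).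
  apply: emeasurable_funB.
  - apply: measurable_fun_fubini_tonelli_G => //.
    by apply: measurable_funepos; exact/measurable_EFinP.
  - apply: measurable_fun_fubini_tonelli_G => //.
    by apply: measurable_funeneg; exact/measurable_EFinP.
apply/funext => x; rewrite [LHS](_ : _ = \int[sig]_s (F \o pair^~ x) s)%E//.
by rewrite [LHS]integralE funepos_comp funeneg_comp.
Qed.

Let section_sqint x : (\int[sig]_s ((b (s, x)) ^+ 2)%:E < +oo)%E ->
  sqint sig (fun s => b (s, x)).
Proof.
by move=> h; apply: sqintP => //; exact: (measurableT_comp mb).
Qed.

Lemma sqint_integrated : sqint mu integrated.
Proof.
apply: sqintP; first exact: measurable_integrated.
pose A := inner sig a a + 1.
(* Strict positivity makes the bound infinite at those [x] whose section of [b] has infinite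
   norm. *)
have A0 : 0 < A by rewrite ltr_wpDl// inner_ge0.
apply: (@le_lt_trans _ _ (\int[mu]_x (A%:E * \int[sig]_s ((b (s, x)) ^+ 2)%:E))%E).
  apply: ge0_le_integral => //.
  - by move=> x _; rewrite lee_fin sqr_ge0.
  - apply/measurable_EFinP; apply: measurable_funX; exact: measurable_integrated.
  - apply: measurable_funeM.
    apply: (@measurable_fun_fubini_tonelli_G _ _ _ _ _ sig (fun z => ((b z) ^+ 2)%:E)).
      by apply/measurable_EFinP; exact: measurable_funX.
    by move=> z; rewrite lee_fin sqr_ge0.
  move=> x _; have := leey (\int[sig]_s ((b (s, x)) ^+ 2)%:E)%E.
  rewrite le_eqVlt => /predU1P[->|blty]; first by rewrite gt0_muley ?lte_fin// leey.
  have sbx := section_sqint blty.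
  rewrite (inner_fin sbx) -EFinM lee_fin.
  have -> : integrated x = inner sig a (fun s => b (s, x)).
    by apply: eq_Rintegral => s _; rewrite kE.
  apply: (le_trans (inner_CS_sqr sa sbx)).
  by rewrite /A mulrDl mul1r lerDl inner_ge0.
rewrite ge0_integralZl//; last 3 first.
- apply: (@measurable_fun_fubini_tonelli_G _ _ _ _ _ sig (fun z => ((b z) ^+ 2)%:E)).
    by apply/measurable_EFinP; exact: measurable_funX.
  by move=> z; rewrite lee_fin sqr_ge0.
- by move=> x _; apply: integral_ge0 => s _; rewrite lee_fin sqr_ge0.
- exact: ltW.
rewrite -(@fubini_tonelli2 _ _ _ _ _ sig mu (fun z => ((b z) ^+ 2)%:E))//; last 2 first.
- by apply/measurable_EFinP; exact: measurable_funX.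
- by move=> z; rewrite lee_fin sqr_ge0.
by rewrite (inner_fin sb) -EFinM ltry.
Qed.

(** Fubini applies because [h x * k s x] is the product of [a s * h x] and [b (s, x)], both
    square-integrable on the product space. *)
Lemma inner_integrated h : sqint mu h ->
  (inner mu h integrated)%:E = (\int[sig]_s \int[mu]_x (h x * k s x)%:E)%E.
Proof.
move=> sh; have sI := sqint_integrated.
have sah : sqint (sig \x mu)%E (fun z => a z.1 * h z.2).
  apply: sqintP.
    apply: measurable_funM.
      exact: measurableT_comp (sqint_measurable sa) measurable_fst.
    exact: measurableT_comp (sqint_measurable sh) measurable_snd.
  rewrite fubini_tonelli1//=; last 2 first.
  - apply/measurable_EFinP; apply: measurable_funX; apply: measurable_funM.
      exact: measurableT_comp (sqint_measurable sa) measurable_fst.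
    exact: measurableT_comp (sqint_measurable sh) measurable_snd.
  - by move=> z; rewrite lee_fin sqr_ge0.
  rewrite (eq_integral (fun s => ((inner mu h h)%:E * ((a s) ^+ 2)%:E)%E)); last first.
    move=> s _; rewrite /fubini_F/= (inner_fin (sqintZ (a s) sh)).
    by rewrite innerZl ?innerZr//; [congr EFin; ring|exact: sqintZ].
  rewrite ge0_integralZl//; last 3 first.
  - by apply/measurable_EFinP; apply: measurable_funX; exact: sqint_measurable sa.
  - by move=> s _; rewrite lee_fin sqr_ge0.
  - by rewrite lee_fin inner_ge0.
  by rewrite (inner_fin sa) -EFinM ltry.
pose F z := (h z.2 * k z.1 z.2)%:E.
have intF : (sig \x mu)%E.-integrable [set: S * X] F.
  rewrite (_ : F = EFin \o (fun z => a z.1 * h z.2 * b z)); first exact: sqint_mul.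
  by apply/funext => -[s x]; rewrite /F/= kE; congr EFin; ring.
have := Fubini intF; rewrite /F/= => ->.
have int1 := sqint_mul sh sI.
rewrite /inner /Rintegral fineK; last exact: (integrable_fin_num _ int1).
apply: ae_eq_integral => //; first exact: measurable_int int1.
  exact: (measurable_fubini_G intF).
(* Sections of [b] are square-integrable for almost every [x] only, which suffices to take [h x] out
   of the integral. *)
have [_ intb] := sb.
apply: filterS (ae_integrable2 intb) => x intbx _.
have sbx : sqint sig (fun s => b (s, x)) by split => //; exact: (measurableT_comp mb).
have intk : sig.-integrable [set: S] (EFin \o (fun s => k s x)).
  rewrite (_ : (fun s => _) = fun s => a s * b (s, x)); first exact: sqint_mul.
  by apply/funext => s; rewrite kE.
rewrite /integrated -RintegralZl// /Rintegral fineK//.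
exact: (integrable_fin_num _ (integrable_scaler (h x) measurableT intk)).
Qed.

Lemma inner_sqrB_integrated h : sqint mu h -> (forall s, sqint mu (k s)) ->
  (inner mu (fun x => h x - integrated x) (fun x => h x - integrated x))%:E =
  ((inner mu h h)%:E - 2%:E * \int[sig]_s (inner mu h (k s))%:E
     + \int[sig]_s \int[sig]_r (inner mu (k s) (k r))%:E)%E.
Proof.
move=> sh sk; have sI := sqint_integrated.
have E f : sqint mu f ->
    (inner mu f integrated)%:E = (\int[sig]_s (inner mu f (k s))%:E)%E.
  move=> sf; rewrite inner_integrated//; apply: eq_integral => s _.
  by rewrite /inner /Rintegral fineK//; exact: (integrable_fin_num _ (sqint_mul sf (sk s))).
rewrite inner_sqrB// EFinD EFinB EFinM E//; congr (_ + _)%E.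
(* The squared norm of [integrated] uses [E] twice: with [f] the integrated family, then with
   [f = k s] for each fixed [s]. *)
rewrite E//; apply: eq_integral => s _.
by rewrite innerC E.
Qed.

End integrated_family.

(** * Isometry and linearity of Wiener integrals *)

Section square_integrable_cvg.
Context d (T : measurableType d) (R : realType) (mu : {measure set T -> \bar R}).

(** [is_wiener_integral] states convergence in the extended reals without assuming its limits
    square-integrable. Some error must be finite, and adding the corresponding [s N] back recovers
    [f]. *)
Lemma cvg_sqint (f : T -> R) (s : nat -> T -> R) :
  measurable_fun [set: T] f -> (forall k, sqint mu (s k)) ->
  (fun k => \int[mu]_x ((f x - s k x) ^+ 2)%:E)%E @ \oo --> 0%E ->
  sqint mu f /\
  (fun k => inner mu (fun x => f x - s k x) (fun x => f x - s k x)) @ \oo --> (0 : R).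
Proof.
move=> mf ss /fine_cvgP[[N _ fin] cvg].
have sfN : sqint mu (fun x => f x - s N x).
  apply: sqintP; first by apply: measurable_funB => //; exact: sqint_measurable (ss N).
  rewrite -ge0_fin_numE; first by apply: fin => /=.
  by apply: integral_ge0 => x _; rewrite lee_fin sqr_ge0.
have sf : sqint mu f.
  rewrite (_ : f = fun x => (f x - s N x) + s N x); first exact: sqintD.
  by apply/funext => x; rewrite subrK.
by split.
Qed.

Lemma inner_ae0 (f : T -> R) : measurable_fun [set: T] f ->
  {ae mu, forall x, f x = 0} -> sqint mu f /\ inner mu f f = 0.
Proof.
move=> mf f0.
have i0 : (\int[mu]_x ((f x) ^+ 2)%:E = 0)%E.
  rewrite (@ae_eq_integral _ _ _ mu _ (cst 0)%E)// ?integral0//.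
    by apply/measurable_EFinP; exact: measurable_funX.
  by apply: filterS f0 => x /= -> _; rewrite expr0n.
have sf : sqint mu f by apply: sqintP => //; rewrite i0.
by split => //; apply/EFin_inj; rewrite -inner_fin.
Qed.

(** Stated for an abstract curve so that one formula serves both the increments of [B] and the
    indicators of intervals. *)
Lemma inner_increments (F : R -> T -> R) :
  (forall u v, 0 <= u -> 0 <= v -> sqint mu (fun x => F u x - F v x)) ->
  (forall u v, 0 <= u -> 0 <= v ->
    inner mu (fun x => F u x - F v x) (fun x => F u x - F v x) = `|u - v|) ->
  forall a b c e, 0 <= a -> 0 <= b -> 0 <= c -> 0 <= e ->
    inner mu (fun x => F b x - F a x) (fun x => F e x - F c x) =
    (`|e - a| - `|b - e| - `|c - a| + `|b - c|) / 2.
Proof.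
move=> sF nF a b c e a0 b0 c0 e0.
(* Polarization for increments with the common base point [a]; the general case subtracts two of
   these. *)
have polar e' : 0 <= e' -> inner mu (fun x => F b x - F a x) (fun x => F e' x - F a x) =
    (`|b - a| + `|e' - a| - `|b - e'|) / 2.
  move=> e'0; rewrite -(nF b a)// -(nF e' a)// -(nF b e')//.
  rewrite (_ : (fun x => F b x - F e' x) =
               fun x => (F b x - F a x) - (F e' x - F a x)); last first.
    by apply/funext => x; ring.
  by rewrite (inner_sqrB (sF _ _ b0 a0) (sF _ _ e'0 a0)); field.
rewrite (_ : (fun x => F e x - F c x) =
             fun x => (F e x - F a x) - (F c x - F a x)); last first.
  by apply/funext => x; ring.
by rewrite (innerBr (sF _ _ e0 a0) (sF _ _ c0 a0) (sF _ _ b0 a0)) !polar//; field.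
Qed.

End square_integrable_cvg.

Section step_functions.
Context {R : realType}.
Notation leb := (@lebesgue_measure R).

Lemma indic_ocE (a b v : R) : \1_(`]a, b]) v = ((a < v) && (v <= b))%:R :> R.
Proof. by rewrite indicE mem_setE in_itv. Qed.

Lemma integral_indic_oc (a b : R) :
  (\int[leb]_x (\1_(`]a, b]) x)%:E = (if a < b then b - a else 0)%:E)%E.
Proof.
rewrite integral_indic//.
transitivity (leb `]a, b]%classic); first by congr (lebesgue_measure _); exact: setIT.
by rewrite lebesgue_measure_itv/= lte_fin; case: ifP.
Qed.

Lemma sqint_indic (a b : R) : sqint leb (\1_(`]a, b])).
Proof.
have m : measurable_fun [set: R] (\1_(`]a, b]) : R -> R).
  exact: measurable_indic.
apply: sqintP => //.
under eq_integral => x _.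
  rewrite (_ : \1_(`]a, b]) x ^+ 2 = \1_(`]a, b]) x); last first.
    by rewrite indicE; case: (_ \in _); rewrite ?expr1n ?expr0n.
  over.
by rewrite integral_indic_oc ltry.
Qed.

Lemma inner_indic_itv (a b : R) : a <= b ->
  inner leb (\1_(`]a, b])) (\1_(`]a, b])) = b - a.
Proof.
move=> ab; rewrite /inner (_ : (fun x => _) = \1_(`]a, b])); last first.
  by apply/funext => x; rewrite indicE; case: (_ \in _); rewrite ?mulr1 ?mulr0.
rewrite /Rintegral integral_indic_oc/=.
by case: ltP => // ba; rewrite (le_anti (introT andP (conj ab ba))) subrr.
Qed.

Lemma indic_ocB (a b v : R) : 0 <= a -> a <= b ->
  \1_(`]a, b]) v = \1_(`]0, b]) v - \1_(`]0, a]) v :> R.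
Proof.
move=> a0 ab; rewrite !indic_ocE.
have [v0|v0] := ltP 0 v => /=; last by rewrite subr0 ltNge (le_trans v0).
have [va|va] := ltP a v; first by rewrite subr0.
by rewrite (le_trans va ab) subrr.
Qed.

(** The curve of indicators of []0, u]] has the increment norms of Brownian motion, so the overlap
    of two intervals needs no discussion of their relative position. *)
Lemma inner_indic_increments (a b c e : R) : 0 <= a -> a <= b -> 0 <= c -> c <= e ->
  inner leb (\1_(`]a, b])) (\1_(`]c, e])) =
  (`|e - a| - `|b - e| - `|c - a| + `|b - c|) / 2.
Proof.
move=> a0 ab c0 ce; rewrite (funext (fun v => indic_ocB v a0 ab)) (funext (fun v => indic_ocB v c0 ce)).
apply: (@inner_increments _ _ _ leb (fun u => \1_(`]0, u]))) => //; last 2 first.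
- exact: le_trans ab.
- exact: le_trans ce.
- by move=> u v _ _; exact: sqintB (sqint_indic _ _) (sqint_indic _ _).
move=> u v; wlog uv : u v / v <= u => [hw u0 v0|u0 v0].
  have [/hw->//|/ltW uv] := leP v u.
  rewrite distrC -hw//; congr Rintegral; apply/funext => x; ring.
by rewrite -(funext (fun x => indic_ocB x v0 uv)) inner_indic_itv// ger0_norm ?subr_ge0.
Qed.

Lemma step_fun_cons z (g : seq (R * R * R)) x :
  step_fun (z :: g) x = z.2 * \1_(`]z.1.1, z.1.2]) x + step_fun g x.
Proof. by rewrite /step_fun big_cons. Qed.

Lemma sqint_step_fun (g : seq (R * R * R)) : sqint leb (step_fun g).
Proof.
by apply: sqint_sum => z; apply: sqintZ; exact: sqint_indic.
Qed.

Lemma step_fun_outside (J : set R) g x : step_in J g -> ~ J x -> step_fun g x = 0.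
Proof.
move=> gJ Jx; rewrite /step_fun big_seq big1// => z /gJ[_ zJ].
by rewrite indicE memNset ?mulr0// => /zJ.
Qed.

End step_functions.

(** * The isometry between functions on the half-line and integrals against [B] *)

Section wiener_pair.
Context d (T : measurableType d) (R : realType) (P : probability T R)
  (B : R -> {RV P >-> R}).
Notation leb := (@lebesgue_measure R).
Hypothesis hB : forall u v, 0 <= u -> 0 <= v ->
  'E_P[fun w => ((B u w - B v w) ^+ 2)%R]%E = `|u - v|%:E.

Let sB u v : 0 <= u -> 0 <= v -> sqint P (fun w => B u w - B v w).
Proof.
move=> u0 v0; apply: sqintP; first exact: measurable_funB.
by move: (hB u0 v0); rewrite unlock => ->; rewrite ltry.
Qed.

Let nB u v : 0 <= u -> 0 <= v ->
  inner P (fun w => B u w - B v w) (fun w => B u w - B v w) = `|u - v|.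
Proof.
move=> u0 v0; apply: EFin_inj; rewrite -inner_fin; last exact: sB.
by move: (hB u0 v0); rewrite unlock.
Qed.

Lemma step_integral_cons (X : R -> {RV P >-> R}) z g w :
  step_integral X (z :: g) w = z.2 * (X z.1.2 w - X z.1.1 w) + step_integral X g w.
Proof. by rewrite /step_integral big_cons. Qed.

(* Only nondegenerate intervals are constrained: an empty one contributes 0. *)
Definition nneg_step (g : seq (R * R * R)) : Prop :=
  forall z, z \in g -> z.1.1 <= z.1.2 /\ (z.1.1 = z.1.2 \/ 0 <= z.1.1).

Lemma nneg_step_in (J : set R) g : (forall x, J x -> 0 <= x) -> step_in J g -> nneg_step g.
Proof.
move=> J0 gJ z /gJ[zz zJ]; split => //.
move: zz; rewrite le_eqVlt => /predU1P[->|zz]; [by left|right].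
rewrite leNgt; apply/negP => z0.
have [m [zm mz m0]] : exists m, [/\ z.1.1 < m, m <= z.1.2 & m < 0].
  (* Since [z.1.1 < 0], its half is negative and strictly to its right; the minimum keeps the point
     inside the interval. *)
  exists (Num.min z.1.2 (z.1.1 / 2)); rewrite lt_min zz ge_min lexx gt_min; split => //.
    lra.
  by apply/orP; right; lra.
have : J m by apply: zJ; rewrite /= in_itv/= zm.
by move=> /J0; rewrite leNgt m0.
Qed.

Let increment_isometry (z z' : R * R * R) :
  z.1.1 <= z.1.2 -> z.1.1 = z.1.2 \/ 0 <= z.1.1 ->
  z'.1.1 <= z'.1.2 -> z'.1.1 = z'.1.2 \/ 0 <= z'.1.1 ->
  [/\ sqint P (fun w => B z.1.2 w - B z.1.1 w),
    sqint P (fun w => B z'.1.2 w - B z'.1.1 w) &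
    inner P (fun w => B z.1.2 w - B z.1.1 w) (fun w => B z'.1.2 w - B z'.1.1 w) =
    inner leb (\1_(`]z.1.1, z.1.2])) (\1_(`]z'.1.1, z'.1.2]))].
Proof.
have triv (y : R * R * R) : y.1.1 = y.1.2 -> (fun w => B y.1.2 w - B y.1.1 w) = (fun=> 0).
  by move=> ->; apply/funext => w; rewrite subrr.
have triv' (y : R * R * R) : y.1.1 = y.1.2 -> \1_(`]y.1.1, y.1.2]) = (fun=> 0) :> (R -> R).
  move=> ->; apply/funext => x; rewrite indic_ocE.
  by case: ltP => //= xy; rewrite leNgt xy.
have sz (y : R * R * R) : y.1.1 <= y.1.2 -> y.1.1 = y.1.2 \/ 0 <= y.1.1 ->
    sqint P (fun w => B y.1.2 w - B y.1.1 w).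
  move=> yy [/triv->|y0]; first exact: sqint0.
  by apply: sB => //; exact: le_trans yy.
move=> h1 h2 h1' h2'; split; [exact: sz|exact: sz|].
have [e|h] := eqVneq z.1.1 z.1.2; first by rewrite triv// triv'// !inner0l.
have [e|h'] := eqVneq z'.1.1 z'.1.2.
  by rewrite (triv z')// (triv' z')// innerC inner0l innerC inner0l.
case: h2 => [/eqP|]; first by rewrite (negbTE h).
case: h2' => [/eqP|]; first by rewrite (negbTE h').
move=> z'0 z0; rewrite inner_indic_increments//.
exact: (inner_increments sB nB z0 (le_trans z0 h1) z'0 (le_trans z'0 h1')).
Qed.

Lemma sqint_step_integral g : nneg_step g -> sqint P (step_integral B g).
Proof.
elim: g => [_|z g IH zg].
  rewrite (_ : step_integral _ _ = (fun=> 0)); first exact: sqint0.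
  by apply/funext => w; rewrite /step_integral big_nil.
rewrite (_ : step_integral _ _ = fun w => z.2 * (B z.1.2 w - B z.1.1 w) + step_integral B g w);
  last by apply/funext => w; rewrite step_integral_cons.
apply: sqintD; last by apply: IH => y yg; apply: zg; rewrite in_cons yg orbT.
apply: sqintZ; have [z1 z2] := zg z (mem_head _ _).
by have [] := increment_isometry z1 z2 z1 z2.
Qed.

Lemma step_isometry g g' : nneg_step g -> nneg_step g' ->
  inner P (step_integral B g) (step_integral B g') =
  inner leb (step_fun g) (step_fun g').
Proof.
have consE z (h : seq (R * R * R)) : step_integral B (z :: h) =
    fun w => z.2 * (B z.1.2 w - B z.1.1 w) + step_integral B h w.
  by apply/funext => w; rewrite step_integral_cons.
have consE' z (h : seq (R * R * R)) : step_fun (z :: h) =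
    fun x => z.2 * \1_(`]z.1.1, z.1.2]) x + step_fun h x.
  by apply/funext => x; rewrite step_fun_cons.
have nil0 : step_integral B [::] = (fun=> 0).
  by apply/funext => w; rewrite /step_integral big_nil.
have nil0' : step_fun [::] = (fun=> 0) :> (R -> R).
  by apply/funext => w; rewrite /step_fun big_nil.
have one z h : nneg_step [:: z] -> nneg_step h ->
    inner P (fun w => B z.1.2 w - B z.1.1 w) (step_integral B h) =
    inner leb (\1_(`]z.1.1, z.1.2])) (step_fun h).
  move=> nz; elim: h => [_|y h IH yh].
    by rewrite nil0 nil0' innerC inner0l innerC inner0l.
  have nh : nneg_step h by move=> x xh; apply: yh; rewrite in_cons xh orbT.
  have [z1 z2] := nz z (mem_head _ _); have [y1 y2] := yh y (mem_head _ _).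
  have [sz sy E] := increment_isometry z1 z2 y1 y2.
  rewrite consE consE' innerDr//; last 2 first.
  - exact: sqintZ.
  - exact: sqint_step_integral.
  rewrite innerDr//; last 3 first.
  - by apply: sqintZ; exact: sqint_indic.
  - exact: sqint_step_fun.
  - exact: sqint_indic.
  by rewrite innerZr// innerZr ?IH ?E//; exact: sqint_indic.
move=> ng ng'; elim: g ng => [_|z g IH zg]; first by rewrite nil0 nil0' !inner0l.
have ng : nneg_step g by move=> x xg; apply: zg; rewrite in_cons xg orbT.
have nz : nneg_step [:: z].
  by move=> x; rewrite inE => /eqP->; apply: zg; rewrite mem_head.
have [z1 z2] := nz z (mem_head _ _).
have [sz _ _] := increment_isometry z1 z2 z1 z2.
have sI := sqint_step_integral ng'; have sS := sqint_step_fun g'.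
rewrite consE consE' innerDl//; last 2 first.
- exact: sqintZ.
- exact: sqint_step_integral.
rewrite innerDl//; last 2 first.
- by apply: sqintZ; exact: sqint_indic.
- exact: sqint_step_fun.
by rewrite innerZl// innerZl ?IH ?one//; exact: sqint_indic.
Qed.

(* [Y] is the integral of [f] over the whole half-line [`]0, +oo[]; integrals over
   subsets are obtained by extending the integrand by 0. *)
Definition wiener_pair (f : R -> R) (Y : T -> R) : Prop :=
  [/\ sqint leb f, sqint P Y & exists g : nat -> seq (R * R * R),
    [/\ forall k, nneg_step (g k),
      (fun k => inner leb (fun x => f x - step_fun (g k) x)
                          (fun x => f x - step_fun (g k) x)) @ \oo --> (0 : R) &
      (fun k => inner P (fun w => Y w - step_integral B (g k) w)
                        (fun w => Y w - step_integral B (g k) w)) @ \oo --> (0 : R)]].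

(** The approximating steps live in [J], so extending [f] by 0 leaves the errors unchanged. *)
Lemma is_wiener_integral_pair (J : set R) f Y : measurable J ->
  (forall x, J x -> 0 <= x) -> is_wiener_integral B J f Y -> wiener_pair (f \_ J) Y.
Proof.
move=> mJ J0 [mf mY [g [gJ cf cY]]].
have ng k := nneg_step_in J0 (gJ k).
have [sY iY] : sqint P Y /\ (fun k => inner P (fun w => Y w - step_integral B (g k) w)
                        (fun w => Y w - step_integral B (g k) w)) @ \oo --> (0 : R).
  apply: cvg_sqint => //; first by move=> k; exact: sqint_step_integral.
  by move: cY; rewrite unlock.
have [sf jf] : sqint leb (f \_ J) /\ (fun k => inner leb (fun x => (f \_ J) x - step_fun (g k) x)
                          (fun x => (f \_ J) x - step_fun (g k) x)) @ \oo --> (0 : R).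
  apply: cvg_sqint => //; first exact: ((measurable_restrictT f mJ).1 mf).
    by move=> k; exact: sqint_step_fun.
  move: cf; under eq_fun do rewrite integral_mkcond.
  apply: cvg_trans; apply: near_eq_cvg; apply: nearW => k.
  apply: eq_integral => x _; rewrite !patchE; case: ifPn => // /negP.
  rewrite inE => Jx.
  by rewrite (step_fun_outside (gJ k) Jx) subr0 expr0n.
by split => //; exists g.
Qed.

(** By [step_isometry] both sides are limits of one and the same sequence. *)
Lemma wiener_pair_inner f Y f' Y' : wiener_pair f Y -> wiener_pair f' Y' ->
  inner P Y Y' = inner leb f f'.
Proof.
move=> [sf sY [g [ng cf cY]]] [sf' sY' [g' [ng' cf' cY']]].
have c1 := cvg_inner (fun k => sqint_step_integral (ng k))
  (fun k => sqint_step_integral (ng' k)) sY sY' cY cY'.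
have c2 := cvg_inner (fun k => sqint_step_fun (g k))
  (fun k => sqint_step_fun (g' k)) sf sf' cf cf'.
have E : (fun k => inner P (step_integral B (g k)) (step_integral B (g' k))) =
    (fun k => inner leb (step_fun (g k)) (step_fun (g' k))).
  by apply/funext => k; rewrite step_isometry.
by rewrite E in c1; exact: (cvg_unique _ c1 c2).
Qed.

Lemma wiener_pairD c f Y f' Y' : wiener_pair f Y -> wiener_pair f' Y' ->
  wiener_pair (fun x => c * f x + f' x) (fun w => c * Y w + Y' w).
Proof.
move=> [sf sY [g [ng cf cY]]] [sf' sY' [g' [ng' cf' cY']]]; split.
- by apply: sqintD => //; exact: sqintZ.
- by apply: sqintD => //; exact: sqintZ.
(* Rescaling the weights of one list and appending the other realizes the linear combination on
   steps. *)
pose sc (z : R * R * R) := (z.1, c * z.2).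
have key d' (T' : measurableType d') (m : {measure set T' -> \bar R}) (F F' G : nat -> T' -> R) :
    (forall k, sqint m (F k)) -> (forall k, sqint m (F' k)) ->
    (forall k x, G k x = c * F k x + F' k x) ->
    (fun k => inner m (F k) (F k)) @ \oo --> (0 : R) ->
    (fun k => inner m (F' k) (F' k)) @ \oo --> (0 : R) ->
    (fun k => inner m (G k) (G k)) @ \oo --> (0 : R).
  move=> sF sF' GE cF cF'.
  apply: (squeeze_cvgr (f := fun=> 0) (h := fun k =>
    2 * c ^+ 2 * inner m (F k) (F k) + 2 * inner m (F' k) (F' k))).
  - near=> k; rewrite inner_ge0/=.
    have -> : G k = fun x => c * F k x + F' k x by apply/funext => x.
    have scF := sqintZ c (sF k); have sF'k := sF' k; have sFk := sF k.
    (* The parallelogram identity: the norms of [c F + F'] and [c F - F'] have squares summing to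
       [2 c^2 |F|^2 + 2 |F'|^2]. *)
    have := inner_ge0 m (fun x => c * F k x - F' k x).
    rewrite inner_sqrB// innerZl// innerZl ?innerZr//.
    rewrite innerDl//; last exact: sqintD.
    rewrite !innerDr// !innerZl// !innerZr// (innerC _ (F' k) (F k)).
    nra.
  - exact: cvg_cst.
  rewrite -[X in _ --> X](_ : 2 * c ^+ 2 * 0 + 2 * 0 = 0); last by ring.
  by apply: cvgD; apply: cvgMl_tmp.
have sfun k x : step_fun (map sc (g k) ++ g' k) x =
    c * step_fun (g k) x + step_fun (g' k) x.
  rewrite /step_fun big_cat big_map/= mulr_sumr; congr (_ + _).
  by apply: eq_bigr => z _; rewrite mulrA.
have sint k w : step_integral B (map sc (g k) ++ g' k) w =
    c * step_integral B (g k) w + step_integral B (g' k) w.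
  rewrite /step_integral big_cat big_map/= mulr_sumr; congr (_ + _).
  by apply: eq_bigr => z _; rewrite mulrA.
exists (fun k => map sc (g k) ++ g' k); split.
- move=> k z; rewrite mem_cat => /orP[/mapP[y yg ->]|]; last exact: ng'.
  by have := ng k y yg.
- apply: (key _ _ _ _ _ _ _ _ _ cf cf').
  + by move=> k; apply: sqintB => //; exact: sqint_step_fun.
  + by move=> k; apply: sqintB => //; exact: sqint_step_fun.
  + by move=> k x; rewrite sfun; ring.
- apply: (key _ _ _ _ _ _ _ _ _ cY cY').
  + by move=> k; apply: sqintB => //; exact: sqint_step_integral.
  + by move=> k; apply: sqintB => //; exact: sqint_step_integral.
  + by move=> k x; rewrite sint; ring.
Unshelve. all: by end_near. Qed.

Lemma wiener_pair0 : wiener_pair (fun=> 0) (fun=> 0).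
Proof.
split; [exact: sqint0|exact: sqint0|exists (fun=> [::]); split => //].
  rewrite (_ : (fun k => _) = (fun=> 0)); first exact: cvg_cst.
  apply/funext => k; rewrite /inner /step_fun.
  under eq_Rintegral do rewrite big_nil subrr mul0r.
  by rewrite /Rintegral integral0.
rewrite (_ : (fun k => _) = (fun=> 0)); first exact: cvg_cst.
apply/funext => k; rewrite /inner /step_integral.
under eq_Rintegral do rewrite big_nil subrr mul0r.
by rewrite /Rintegral integral0.
Qed.

(** The single step []0, t]] integrates to [B t - B 0]; the error is [B 0], which has norm 0. *)
Lemma wiener_pair_point t : 0 <= t -> {ae P, forall w, B 0 w = 0} ->
  wiener_pair (\1_(`]0, t])) (B t).
Proof.
move=> t0 B0.
have [s0 i0] := inner_ae0 (measurable_funP (B 0)) B0.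
have BtE : B t = (fun w => (B t w - B 0 w) + B 0 w) :> (T -> R).
  by apply/funext => w; rewrite subrK.
split; first exact: sqint_indic.
  by rewrite BtE; apply: sqintD => //; exact: sB.
exists (fun=> [:: (0, t, 1)]); split.
- by move=> k z; rewrite inE => /eqP->/=; split => //; right.
- rewrite (_ : (fun k => _) = (fun=> 0)); first exact: cvg_cst.
  apply/funext => k; rewrite /inner /step_fun.
  under eq_Rintegral do rewrite big_seq1/= mul1r subrr mul0r.
  by rewrite /Rintegral integral0.
rewrite (_ : (fun k => _) = (fun=> 0)); first exact: cvg_cst.
apply/funext => k; rewrite -[RHS]i0; congr inner; apply/funext => w;
  by rewrite /step_integral big_seq1/=; ring.
Qed.

(** * From integrals against [W] to integrals against [B] *)

Section lamperti.
Variable W : R -> {RV P >-> R}.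
Hypothesis hWB : lamperti_brownian_motion B W.

Let isqrt (v : R) : R := (Num.sqrt v)^-1.

(** The difference of indicators covers both signs of [u]: it is the indicator of []1, e^u]] when
    [u >= 0] and minus that of []e^u, 1]] when [u <= 0]. *)
Lemma wiener_pair_lamperti u :
  wiener_pair (fun v => isqrt v * (\1_(`]0, expR u]) v - \1_(`]0, 1]) v))
    (fun w => W u w - B 1 w).
Proof.
have e0 := expR_gt0 u.
have [u0|/ltW u0] := leP 0 u.
  have [h _] := hWB.
  have e1 : 1 <= expR u by rewrite -expR0 ler_expR.
  have := is_wiener_integral_pair _ _ (h u u0).
  rewrite (_ : isqrt \_ _ = fun v => isqrt v * (\1_(`]0, expR u]) v - \1_(`]0, 1]) v)).
    apply => // x; rewrite /= in_itv/= => /andP[x1 _].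
    by apply: ltW; exact: lt_trans x1.
  apply/funext => v; rewrite patchE -(indic_ocB v ler01 e1) indicE.
  by case: ifP => _; rewrite ?mulr1 ?mulr0.
have [_ h] := hWB.
have e1 : expR u <= 1 by rewrite -expR0 ler_expR.
have := is_wiener_integral_pair _ _ (h u u0).
have -> : isqrt \_ `]expR u, 1] = fun v => isqrt v * (\1_(`]0, 1]) v - \1_(`]0, expR u]) v).
  apply/funext => v; rewrite patchE -(indic_ocB v (ltW e0) e1) indicE.
  by case: ifP => _; rewrite ?mulr1 ?mulr0.
move=> /(_ (measurable_itv _)) wp.
have {wp}/(wiener_pairD (-1))/(_ wiener_pair0) : wiener_pair
    (fun v => isqrt v * (\1_(`]0, 1]) v - \1_(`]0, expR u]) v)) (fun w => B 1 w - W u w).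
  apply: wp => x; rewrite /= in_itv/= => /andP[x1 _].
  by apply: ltW; exact: lt_trans x1.
by congr wiener_pair; apply/funext => x; ring.
Qed.

(** The change of variable [r = ln v]: an interval []a, b]] for [W] becomes []e^a, e^b]] for [B],
    with density [v^(-1/2)]. *)
Lemma wiener_pair_lamperti_step (J : set R) g : step_in J g ->
  wiener_pair (fun v => isqrt v * step_fun g (ln v)) (step_integral W g).
Proof.
elim: g => [_|z g IH zg].
  rewrite (_ : (fun v => _) = (fun=> 0)); last first.
    by apply/funext => v; rewrite /step_fun big_nil mulr0.
  rewrite (_ : step_integral _ _ = (fun=> 0)); first exact: wiener_pair0.
  by apply/funext => v; rewrite /step_integral big_nil.
have {IH} wg : wiener_pair (fun v => isqrt v * step_fun g (ln v)) (step_integral W g).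
  by apply: IH => y yg; apply: zg; rewrite in_cons yg orbT.
have [zz _] := zg z (mem_head _ _).
have wz := wiener_pairD (-1) (wiener_pair_lamperti z.1.1) (wiener_pair_lamperti z.1.2).
have := wiener_pairD z.2 wz wg.
rewrite (_ : step_integral W (z :: g) = fun w => z.2 * (-1 * (W z.1.1 w - B 1 w) + (W z.1.2 w - B 1 w))
    + step_integral W g w); last first.
  by apply/funext => w; rewrite step_integral_cons; ring.
congr wiener_pair; apply/funext => v; rewrite step_fun_cons.
(* For [v <= 0] the inverse square root is 0, so the value of [ln v] does not matter. *)
have [v0|v0] := ltP 0 v; last first.
  by rewrite /isqrt ler0_sqrtr// invr0; ring.
rewrite [RHS]mulrDr; congr (_ + _).
suff -> : \1_(`]z.1.1, z.1.2]) (ln v) = \1_(`]0, expR z.1.2]) v - \1_(`]0, expR z.1.1]) v :> R.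
  ring.
have := @indic_ocB R (expR z.1.1) (expR z.1.2) v (expR_ge0 _).
rewrite ler_expR => /(_ zz) <-.
by rewrite !indic_ocE -{3 4}(lnK v0) ltr_expR ler_expR.
Qed.

End lamperti.

End wiener_pair.

(** * Calculus on the half-line *)

Section calculus.
Context {R : realType}.
Notation leb := (@lebesgue_measure R).
Implicit Types (F f psi chi : R -> R) (x df dF : R).

Lemma is_derive_continuous F x df : is_derive x 1 F df -> {for x, continuous F}.
Proof. by move=> [dF _]; apply: differentiable_continuous; exact/derivable1_diffP. Qed.

Lemma is_derive_mul F f x dF df : is_derive x 1 F dF -> is_derive x 1 f df ->
  is_derive x 1 (fun y => F y * f y) (dF * f x + F x * df).
Proof.
move=> h1 h2; rewrite (_ : _ + _ = F x *: df + f x *: dF); first exact: is_deriveM.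
by rewrite /GRing.scale/=; ring.
Qed.

Lemma is_derive_add F f x dF df : is_derive x 1 F dF -> is_derive x 1 f df ->
  is_derive x 1 (fun y => F y + f y) (dF + df).
Proof. exact: is_deriveD. Qed.

Lemma is_derive_scale F c x dF : is_derive x 1 F dF ->
  is_derive x 1 (fun y => c * F y) (c * dF).
Proof. exact: is_deriveZ. Qed.

Lemma is_derive_const (c x : R) : is_derive x 1 (fun=> c) 0.
Proof. exact: is_derive_cst. Qed.

Lemma is_derive_linear (c x : R) : is_derive x 1 (fun y => c * y) c.
Proof. by rewrite -[X in is_derive _ _ _ X]mulr1; apply: is_derive_scale; exact: is_derive_id. Qed.

Lemma is_derive_expc (c x : R) :
  is_derive x 1 (fun y => expR (c * y)) (c * expR (c * x)).
Proof.
rewrite mulrC; apply: (is_derive1_comp (f := expR) (g := fun y => c * y)).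
exact: is_derive_linear.
Qed.

Lemma is_derive_cosc (c x : R) :
  is_derive x 1 (fun y => cos (c * y)) (- c * sin (c * x)).
Proof.
rewrite mulNr mulrC -mulNr; apply: (is_derive1_comp (f := @cos R) (g := fun y => c * y)).
exact: is_derive_linear.
Qed.

Lemma is_derive_sinc (c x : R) :
  is_derive x 1 (fun y => sin (c * y)) (c * cos (c * x)).
Proof.
rewrite mulrC; apply: (is_derive1_comp (f := @sin R) (g := fun y => c * y)).
exact: is_derive_linear.
Qed.

Lemma is_derive_bigsum (I : Type) (s : seq I) (F : I -> R -> R) (dF : I -> R) (x : R) :
  (forall i, is_derive x 1 (F i) (dF i)) ->
  is_derive x 1 (fun y => \sum_(i <- s) F i y) (\sum_(i <- s) dF i).
Proof.
move=> h; elim: s => [|i s IH].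
  rewrite big_nil (_ : (fun y => _) = (fun=> 0)); first exact: is_derive_const.
  by apply/funext => y; rewrite big_nil.
rewrite big_cons (_ : (fun y => _) = (fun y => F i y + \sum_(j <- s) F j y)).
  exact: is_derive_add.
by apply/funext => y; rewrite big_cons.
Qed.

Lemma integral_derivative F f a b : a < b ->
  (forall x, a <= x <= b -> is_derive x 1 F (f x)) ->
  (forall x, a <= x <= b -> {for x, continuous f}) ->
  (\int[leb]_(x in `[a, b]) (f x)%:E = (F b - F a)%:E)%E.
Proof.
move=> ab dF cf; have cF x : a <= x <= b -> {for x, continuous F}.
  by move=> xab; exact: is_derive_continuous (dF x xab).
rewrite (@continuous_FTC2 _ f F)//.
- apply: continuous_in_subspaceT => x; rewrite inE/= in_itv/=; exact: cf.
- split.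
  + move=> x; rewrite in_itv/= => /andP[ax xb].
    by have [] := dF x; rewrite ?(ltW ax) ?(ltW xb).
  + by apply: cvg_at_right_filter; apply: cF; rewrite lexx ltW.
  + by apply: cvg_at_left_filter; apply: cF; rewrite lexx ltW.
- move=> x; rewrite in_itv/= => /andP[ax xb]; rewrite derive1E.
  have xab : a <= x <= b by rewrite (ltW ax) (ltW xb).
  by have [_ ->] := dF x xab.
Qed.

Definition exp_bounded f (C c : R) := forall x, 0 <= x -> `|f x| <= C * expR (- c * x).

Lemma cvg_expRNc (c : R) : 0 < c -> expR (- c * x) @[x --> +oo%R] --> (0 : R).
Proof.
move=> c0; under eq_fun do rewrite mulNr.
apply: (@cvg_comp _ _ _ (fun x => c * x) (fun y => expR (- y)) _ (pinfty_nbhs R)).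
- by apply: gt0_cvgMry => //; exact: cvg_id.
- exact: cvgr_expR.
Qed.

Lemma cvg_exp_bounded f C c : 0 < c -> exp_bounded f C c -> f x @[x --> +oo%R] --> (0 : R).
Proof.
move=> c0 fC; apply/norm_cvg0P.
apply: (squeeze_cvgr (f := fun=> 0) (h := fun x => C * expR (- c * x))).
- near=> x; rewrite normr_ge0 fC//.
- exact: cvg_cst.
- by rewrite -[X in _ --> X](mulr0 C); apply: cvgMl_tmp; exact: cvg_expRNc.
Unshelve. all: by end_near. Qed.

Lemma integral_expRN (C c b : R) : 0 <= C -> 0 < c ->
  (\int[leb]_(x in `[b, +oo[) (C * expR (- c * x))%:E = (C / c * expR (- c * b))%:E)%E.
Proof.
move=> C0 c0; pose F x := - (C / c) * expR (- c * x).
have dF x : is_derive x 1 F (C * expR (- c * x)).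
  rewrite (_ : C * _ = - (C / c) * (- c * expR (- c * x))); last by field; rewrite gt_eqF.
  by apply: is_derive_scale; exact: is_derive_expc.
have cf x : {for x, continuous (fun x => C * expR (- c * x))}.
  exact: is_derive_continuous (is_derive_scale _ (is_derive_expc _ _)).
rewrite (@ge0_continuous_FTC2y _ _ F b 0).
- by rewrite /F -EFinB sub0r mulNr opprK.
- by move=> x _; rewrite mulr_ge0// expR_ge0.
- by apply: continuous_subspaceT => x; exact: cf.
- by rewrite -[X in _ --> X](mulr0 (- (C / c))); apply: cvgMl_tmp; exact: cvg_expRNc.
- by move=> x _; have [] := dF x.
- by apply: cvg_at_right_filter; exact: is_derive_continuous (dF b).
- by move=> x _; rewrite derive1E; have [_ ->] := dF x.
Qed.

Lemma integrable_exp_bounded f C c : 0 < c -> measurable_fun [set: R] f ->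
  exp_bounded f C c -> leb.-integrable `[0, +oo[ (EFin \o f).
Proof.
move=> c0 mf fC; have C0 : 0 <= C.
  by have := fC 0 (lexx 0); rewrite mulr0 expR0 mulr1; exact: le_trans.
apply: (@le_integrable _ _ _ leb _ _ _ (EFin \o (fun x => C * expR (- c * x)))) => //.
- by apply/measurable_EFinP; exact: measurable_funTS.
- move=> x /=; rewrite in_itv/= andbT => x0; rewrite lee_fin.
  by rewrite [leRHS]ger0_norm ?mulr_ge0 ?expR_ge0// fC.
apply/integrableP; split.
  apply/measurable_EFinP; apply: measurable_funTS; apply: measurable_funM => //.
  by apply: measurableT_comp => //; exact: measurable_funM.
under eq_integral do rewrite /= ger0_norm ?mulr_ge0 ?expR_ge0//.
by rewrite integral_expRN// ltry.
Qed.

(** Adding the dominating exponential makes the integrand nonnegative, so that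
    [ge0_continuous_FTC2y] applies; the added integral [C / c] is subtracted afterwards. *)
Lemma Rintegral_derivative_y F f C c : 0 < c ->
  (forall x, is_derive x 1 F (f x)) -> continuous f ->
  exp_bounded f C c -> exp_bounded F C c ->
  \int[leb]_(x in `[0, +oo[) f x = - F 0.
Proof.
move=> c0 dF cf fC FC; have C0 : 0 <= C.
  by have := fC 0 (lexx 0); rewrite mulr0 expR0 mulr1; exact: le_trans.
have mf : measurable_fun [set: R] f by exact: continuous_measurable_fun.
have intf := integrable_exp_bounded c0 mf fC.
pose e x := C * expR (- c * x).
have inte : leb.-integrable `[0, +oo[ (EFin \o e).
  apply: (@integrable_exp_bounded e C c) => //.
    apply: measurable_funM => //.
    by apply: measurableT_comp => //; exact: measurable_funM.
  by move=> x _; rewrite ger0_norm// mulr_ge0// expR_ge0.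
pose G x := F x - (C / c) * expR (- c * x).
have dG x : is_derive x 1 G (f x + e x).
  rewrite /e (_ : C * _ = - (C / c) * (- c * expR (- c * x))); last by field; rewrite gt_eqF.
  rewrite /G; under eq_fun do rewrite -mulNr.
  by apply: is_derive_add => //; apply: is_derive_scale; exact: is_derive_expc.
have := @ge0_continuous_FTC2y _ (fun x => f x + e x) G 0 0.
have E : \int[leb]_(x in `[0, +oo[) f x = \int[leb]_(x in `[0, +oo[) (f x + e x) - C / c.
  rewrite RintegralD//; rewrite [X in _ + X - _](_ : _ = C / c) ?addrK//.
  by rewrite /Rintegral integral_expRN// mulr0 expR0 mulr1.
rewrite E /Rintegral => ->.
- by rewrite /G mulr0 expR0 mulr1 /=; ring.
- move=> x x0; have := fC x x0; rewrite ler_norml => /andP[h _].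
  by rewrite /e -lerBlDr sub0r.
- apply: continuous_subspaceT => x; apply: continuousD; first exact: cf.
  exact: is_derive_continuous (is_derive_scale _ (is_derive_expc _ _)).
- rewrite -[X in _ --> X](subr0 0); apply: cvgB; first exact: (cvg_exp_bounded c0 FC).
  by rewrite -[X in _ --> X](mulr0 (C / c)); apply: cvgMl_tmp; exact: cvg_expRNc.
- by move=> x _; have [] := dG x.
- by apply: cvg_at_right_filter; exact: is_derive_continuous (dG 0).
- by move=> x _; rewrite derive1E; have [_ ->] := dG x.
Qed.

(* Real and imaginary parts of [(a - i xi) psihat = psi 0 + chihat], obtained by
   integrating the derivative of [e^{i xi x} psi x]. *)
Lemma fourier_ode psi chi (a C c xi : R) : 0 < c ->
  (forall x, is_derive x 1 psi (- a * psi x + chi x)) -> continuous chi ->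
  exp_bounded psi C c -> exp_bounded chi C c ->
  let Ic f := \int[leb]_(x in `[0, +oo[) (cos (xi * x) * f x) in
  let Is f := \int[leb]_(x in `[0, +oo[) (sin (xi * x) * f x) in
  a * Ic psi + xi * Is psi = psi 0 + Ic chi /\
  a * Is psi - xi * Ic psi = Is chi.
Proof.
move=> c0 dpsi cchi bpsi bchi Ic Is.
have cpsi : continuous psi by move=> x; exact: is_derive_continuous (dpsi x).
have ccos : continuous (fun x => cos (xi * x)).
  by move=> x; exact: is_derive_continuous (is_derive_cosc _ _).
have csin : continuous (fun x => sin (xi * x)).
  by move=> x; exact: is_derive_continuous (is_derive_sinc _ _).
have C0 : 0 <= C.
  by have := bpsi 0 (lexx 0); rewrite mulr0 expR0 mulr1; exact: le_trans.
have bmul (g f : R -> R) : (forall x, `|g x| <= 1) -> exp_bounded f C c ->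
    exp_bounded (fun x => g x * f x) C c.
  move=> g1 fC x x0; rewrite normrM -[leRHS]mul1r ler_pM//; exact: fC.
have cos1 x : `|cos (xi * x)| <= 1 by rewrite ler_norml cos_geN1 cos_le1.
have sin1 x : `|sin (xi * x)| <= 1 by rewrite ler_norml sin_geN1 sin_le1.
have icmul (g f : R -> R) : (forall x, `|g x| <= 1) -> continuous g -> continuous f ->
    exp_bounded f C c -> leb.-integrable `[0, +oo[ (EFin \o (fun x => g x * f x)).
  move=> g1 cg cf bf; apply: (integrable_exp_bounded c0 _ (bmul _ _ g1 bf)).
  by apply: continuous_measurable_fun => x; apply: continuousM; [exact: cg|exact: cf].
have i1 := icmul _ _ cos1 ccos cpsi bpsi.
have i2 := icmul _ _ sin1 csin cpsi bpsi.
have i3 := icmul _ _ cos1 ccos cchi bchi.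
have i4 := icmul _ _ sin1 csin cchi bchi.
(* One constant bounding both [g psi] and its derivative, whose three terms carry the factors [xi],
   [a] and 1. *)
pose D := C * (`|a| + `|xi| + 1).
have CD : C <= D by rewrite /D ler_peMr// lerDr addr_ge0.
have bF g : (forall x, `|g x| <= 1) -> exp_bounded (fun x => g x * psi x) D c.
  move=> g1 x x0; apply: (le_trans (bmul _ _ g1 bpsi x x0)).
  by rewrite ler_wpM2r// expR_ge0.
have bf (g h : R -> R) (s : R) : (forall x, `|g x| <= 1) -> (forall x, `|h x| <= 1) ->
    `|s| <= `|xi| ->
    exp_bounded (fun x => s * (h x * psi x) + (- a * (g x * psi x) + g x * chi x)) D c.
  move=> g1 h1 sxi x x0.
  have := bmul _ _ h1 bpsi x x0; have := bmul _ _ g1 bpsi x x0; have := bmul _ _ g1 bchi x x0.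
  set e := expR _ => b1 b2 b3.
  apply: (le_trans (ler_normD _ _)); apply: (le_trans (lerD (lexx _) (ler_normD _ _))).
  rewrite !(normrM s) !(normrM (- a)) normrN.
  have -> : D * e = `|xi| * (C * e) + (`|a| * (C * e) + C * e) by rewrite /D; ring.
  by rewrite lerD// ?ler_pM// lerD// ler_wpM2l.
(* Here [g] is the cosine or the sine, and [s * h] is its derivative. *)
have key (g h : R -> R) (s : R) : (forall x, `|g x| <= 1) -> (forall x, `|h x| <= 1) ->
    `|s| <= `|xi| -> continuous h -> (forall x, is_derive x 1 g (s * h x)) ->
    s * \int[leb]_(x in `[0, +oo[) (h x * psi x) +
      (- a * \int[leb]_(x in `[0, +oo[) (g x * psi x)
       + \int[leb]_(x in `[0, +oo[) (g x * chi x)) = - (g 0 * psi 0).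
  move=> g1 h1 sxi ch dg.
  have cg : continuous g by move=> x; exact: is_derive_continuous (dg x).
  have ih := icmul _ _ h1 ch cpsi bpsi.
  have ig := icmul _ _ g1 cg cpsi bpsi.
  have ig' := icmul _ _ g1 cg cchi bchi.
  rewrite -!RintegralZl//.
  rewrite -RintegralD//; last exact: integrable_scaler.
  rewrite -RintegralD//; last 2 first.
  - exact: integrable_scaler.
  - by apply: integrable_addr => //; exact: integrable_scaler.
  apply: (Rintegral_derivative_y (F := fun x => g x * psi x) c0 _ _ (bf _ _ _ g1 h1 sxi) (bF _ g1)).
  - move=> x; rewrite (_ : _ + _ = s * h x * psi x + g x * (- a * psi x + chi x)); last by ring.
    exact: is_derive_mul.
  - move=> x; apply: cvgD; first by apply: cvgM; [exact: cvg_cst|apply: cvgM; [exact: ch|exact: cpsi]].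
    apply: cvgD; last by apply: cvgM; [exact: cg|exact: cchi].
    by apply: cvgM; [exact: cvg_cst|apply: cvgM; [exact: cg|exact: cpsi]].
split.
- have := key _ _ (- xi) cos1 sin1 _ csin (is_derive_cosc xi).
  rewrite normrN mulr0 cos0 mul1r => /(_ (lexx _)); rewrite /Ic /Is; lra.
- have := key _ _ xi sin1 cos1 (lexx _) ccos (is_derive_sinc xi).
  rewrite mulr0 sin0 mul0r /Ic /Is; lra.
Qed.

End calculus.

(** * The moving average kernel and its Fourier transform *)

Section exponential_decay.
Context {R : realType}.
Implicit Types f g : R -> R.

Definition exp_decay f := exists C c, 0 < c /\ exp_bounded f C c.

Lemma exp_bounded_weaken f (C c C' c' : R) :
  exp_bounded f C c -> C <= C' -> c' <= c -> exp_bounded f C' c'.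
Proof.
move=> fC CC' cc' x x0; have C0 : 0 <= C.
  by have := fC 0 (lexx 0); rewrite mulr0 expR0 mulr1; exact: le_trans.
apply: (le_trans (fC x x0)); rewrite ler_pM ?expR_ge0// ler_expR.
by rewrite !mulNr lerN2 ler_wpM2r.
Qed.

Lemma exp_decay_common f g : exp_decay f -> exp_decay g ->
  exists C c, [/\ 0 < c, exp_bounded f C c & exp_bounded g C c].
Proof.
move=> [C [c [c0 fC]]] [D [e [e0 gD]]]; exists (Num.max C D), (Num.min c e); split.
- by rewrite lt_min c0 e0.
- by apply: exp_bounded_weaken fC _ _; rewrite ?le_max ?ge_min lexx.
- by apply: exp_bounded_weaken gD _ _; rewrite ?le_max ?ge_min lexx orbT.
Qed.

Lemma exp_decayD f g : exp_decay f -> exp_decay g -> exp_decay (fun x => f x + g x).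
Proof.
move=> /exp_decay_common/[apply] -[C [c [c0 fC gC]]]; exists (C + C), c; split => // x x0.
by rewrite mulrDl (le_trans (ler_normD _ _))// lerD// ?fC ?gC.
Qed.

Lemma exp_decayZ f (k : R) : exp_decay f -> exp_decay (fun x => k * f x).
Proof.
move=> [C [c [c0 fC]]]; exists (`|k| * C), c; split => // x x0.
by rewrite normrM -mulrA ler_wpM2l// fC.
Qed.

Lemma exp_decay0 : exp_decay (fun=> 0).
Proof. by exists 0, 1; split => // x _; rewrite normr0 mul0r. Qed.

Lemma exp_decay_sum (I : Type) (s : seq I) (F : I -> R -> R) :
  (forall i, exp_decay (F i)) -> exp_decay (fun x => \sum_(i <- s) F i x).
Proof.
move=> h; elim: s => [|i s IH].
  by under eq_fun do rewrite big_nil; exact: exp_decay0.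
by under eq_fun do rewrite big_cons; exact: exp_decayD.
Qed.

Lemma exp_decay_expR (c : R) : 0 < c -> exp_decay (fun x => expR (- c * x)).
Proof. by move=> c0; exists 1, c; split => // x _; rewrite ger0_norm ?expR_ge0// mul1r. Qed.

(** The integral of [e^(-l y)] over [[0, x]]; the linear case occurs because [lam j = 0] is
    allowed. *)
Definition exp_primitive (l x : R) : R :=
  if l == 0 then x else (1 - expR (- l * x)) / l.

Lemma exp_primitive0 (l : R) : exp_primitive l 0 = 0.
Proof. by rewrite /exp_primitive; case: ifP; rewrite ?mulr0 ?expR0 ?subrr ?mul0r. Qed.

Lemma is_derive_exp_primitive (l x : R) :
  is_derive x 1 (exp_primitive l) (expR (- l * x)).
Proof.
rewrite /exp_primitive; have [->|l0] := eqVneq l 0.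
  by rewrite oppr0 mul0r expR0; exact: is_derive_id.
rewrite (_ : (fun x => _) = fun x => l^-1 * (1 + (-1) * expR (- l * x))); last first.
  by apply/funext => y; rewrite mulrC mulN1r.
rewrite [X in is_derive _ _ _ X](_ : _ = l^-1 * (0 + (-1) * (- l * expR (- l * x)))); last by field.
apply: is_derive_scale; apply: is_derive_add.
apply: is_derive_scale; exact: is_derive_expc.
Qed.

Lemma exp_decay_primitive (l : R) : - (1 / 2) < l ->
  exp_decay (fun x => expR (- (1 / 2) * x) * exp_primitive l x).
Proof.
move=> hl; rewrite /exp_primitive; have [l0|l0] := eqVneq l 0.
  (* Half of the rate absorbs the linear factor: [x <= 4 e^(x/4)]. *)
  exists 4, (1 / 4); split => [|x x0]; first by lra.
  rewrite ger0_norm ?mulr_ge0 ?expR_ge0//.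
  have -> : - (1 / 2) * x = - (1 / 4) * x - x / 4 by field.
  rewrite expRB -mulrA mulrC ler_wpM2r ?expR_ge0// mulrC ler_pdivrMr ?expR_gt0//.
  by have := expR_ge1Dx (x / 4); lra.
rewrite (_ : (fun x => _) = fun x => l^-1 * expR (- (1 / 2) * x) +
    (- l^-1) * expR (- (l + 1 / 2) * x)); last first.
  apply/funext => x; rewrite (_ : - (l + 1 / 2) * x = - (1 / 2) * x + - l * x); last by ring.
  by rewrite expRD; field.
apply: exp_decayD; apply: exp_decayZ; apply: exp_decay_expR; lra.
Qed.

End exponential_decay.

(** * The kernel [phi] and its transform on the half-line *)

Section muntz_profile.
Context {R : realType} (n : nat) (lam : 'I_n -> R).
Hypothesis lam_gt : forall j, - (1 / 2) < lam j.
Notation a := (muntz_coef lam).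
Notation leb := (@lebesgue_measure R).

Definition muntz_profile (x : R) : R :=
  expR (- (1 / 2) * x) * (1 - \sum_(j < n) a j * exp_primitive (lam j) x).

Definition muntz_forcing (x : R) : R :=
  \sum_(j < n) (- a j) * expR (- (lam j + 1 / 2) * x).

Lemma muntz_profile0 : muntz_profile 0 = 1.
Proof.
rewrite /muntz_profile mulr0 expR0 mul1r big1 ?subr0// => j _.
by rewrite exp_primitive0 mulr0.
Qed.

Lemma is_derive_muntz_profile (x : R) : is_derive x 1 muntz_profile
  (- (1 / 2) * muntz_profile x + muntz_forcing x).
Proof.
rewrite [X in is_derive _ _ _ X](_ : _ = - (1 / 2) * expR (- (1 / 2) * x) *
   (1 + (-1) * \sum_(j < n) a j * exp_primitive (lam j) x) + expR (- (1 / 2) * x) *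
   (0 + (-1) * \sum_(j < n) a j * expR (- lam j * x))); last first.
  rewrite /muntz_profile /muntz_forcing add0r !mulN1r mulrA; congr (_ + _).
  rewrite mulrN mulr_sumr -sumrN; apply: eq_bigr => j _.
  rewrite (_ : - (lam j + 1 / 2) * x = - (1 / 2) * x + - lam j * x); last by ring.
  by rewrite expRD; ring.
rewrite /muntz_profile; under eq_fun do rewrite -(mulN1r (\sum_(j < n) _)).
apply: is_derive_mul; first exact: is_derive_expc.
apply: is_derive_add.
apply: is_derive_scale; apply: is_derive_bigsum => j.
by apply: is_derive_scale; exact: is_derive_exp_primitive.
Qed.

Lemma continuous_muntz_profile : continuous muntz_profile.
Proof. by move=> x; exact: is_derive_continuous (is_derive_muntz_profile x). Qed.

Lemma continuous_muntz_forcing : continuous muntz_forcing.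
Proof.
move=> x; exact: is_derive_continuous (is_derive_bigsum _ (fun j =>
  is_derive_scale (- a j) (is_derive_expc (- (lam j + 1 / 2)) x))).
Qed.

Lemma exp_decay_muntz_profile : exp_decay muntz_profile.
Proof.
rewrite (_ : muntz_profile = fun x => expR (- (1 / 2) * x) +
   \sum_(j < n) (- a j) * (expR (- (1 / 2) * x) * exp_primitive (lam j) x)).
  apply: exp_decayD; first by apply: exp_decay_expR; lra.
  by apply: exp_decay_sum => j; apply: exp_decayZ; exact: exp_decay_primitive.
apply/funext => x; rewrite /muntz_profile mulrDr mulr1 mulrN mulr_sumr -sumrN; congr (_ + _).
by apply: eq_bigr => j _; ring.
Qed.

Lemma exp_decay_muntz_forcing : exp_decay muntz_forcing.
Proof.
apply: exp_decay_sum => j; apply: exp_decayZ; apply: exp_decay_expR.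
by have := lam_gt j; lra.
Qed.

Definition half_fourier (f : R -> R) (xi : R) : R[i] :=
  Complex (\int[leb]_(x in `[0, +oo[) (cos (xi * x) * f x))
          (\int[leb]_(x in `[0, +oo[) (sin (xi * x) * f x)).

Lemma half_fourier_ode psi chi (b xi : R) :
  (forall x : R, is_derive x 1 psi (- b * psi x + chi x)) -> continuous chi ->
  exp_decay psi -> exp_decay chi ->
  (b -i* xi)%C * half_fourier psi xi = (psi 0)%:C%C + half_fourier chi xi.
Proof.
move=> dpsi cchi /exp_decay_common/[apply] -[C [c [c0 bpsi bchi]]].
have [h1 h2] := fourier_ode xi c0 dpsi cchi bpsi bchi.
rewrite /half_fourier; apply/eqP; rewrite eq_complex/=; apply/andP; split; apply/eqP.
  by rewrite -h1; ring.
by rewrite add0r -h2; ring.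
Qed.

(** The exponential solves the homogeneous equation, so this is the case of zero forcing. *)
Lemma half_fourier_expR (p xi : R) : 0 < p ->
  half_fourier (fun x => expR (- p * x)) xi = ((p -i* xi)%C)^-1.
Proof.
move=> p0; have pxi : (p -i* xi)%C != 0 by rewrite eq_complex/= gt_eqF.
have d0 (x : R) : is_derive x 1 (fun x => expR (- p * x)) (- p * expR (- p * x) + 0).
  by rewrite addr0; exact: is_derive_expc.
have c0 : continuous (fun _ : R => 0 : R) by exact: cst_continuous.
have e : half_fourier (fun=> 0) xi = 0.
  by rewrite /half_fourier; under eq_Rintegral do rewrite mulr0;
     under [in X in Complex _ X]eq_Rintegral do rewrite mulr0;
     rewrite /Rintegral integral0.
apply: (mulfI pxi); rewrite mulfV//.
by rewrite (half_fourier_ode xi d0 c0 (exp_decay_expR p0) exp_decay0) e addr0 mulr0 expR0.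
Qed.

Lemma integrable_trig_decay f (xi : R) : continuous f -> exp_decay f ->
  leb.-integrable `[0, +oo[ (EFin \o (fun x => cos (xi * x) * f x)) /\
  leb.-integrable `[0, +oo[ (EFin \o (fun x => sin (xi * x) * f x)).
Proof.
move=> cf [C [c [c0 bf]]].
have icmul (k : R -> R) : continuous k -> (forall x, `|k x| <= 1) ->
    leb.-integrable `[0, +oo[ (EFin \o (fun x => k x * f x)).
  move=> ck k1; apply: (integrable_exp_bounded c0 (C := C)).
    by apply: continuous_measurable_fun => x; apply: cvgM; [exact: ck|exact: cf].
  by move=> x x0; rewrite normrM -[leRHS]mul1r ler_pM//; exact: bf.
split; apply: icmul.
- by move=> x; exact: is_derive_continuous (is_derive_cosc _ _).
- by move=> x; rewrite ler_norml cos_geN1 cos_le1.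
- by move=> x; exact: is_derive_continuous (is_derive_sinc _ _).
- by move=> x; rewrite ler_norml sin_geN1 sin_le1.
Qed.

Lemma half_fourierD f g xi : continuous f -> continuous g -> exp_decay f -> exp_decay g ->
  half_fourier (fun x => f x + g x) xi = half_fourier f xi + half_fourier g xi.
Proof.
move=> cf cg df dg; rewrite /half_fourier; apply/eqP; rewrite eq_complex/=.
have [icf isf] := integrable_trig_decay xi cf df.
have [icg isg] := integrable_trig_decay xi cg dg.
by apply/andP; split; apply/eqP; under eq_Rintegral do rewrite mulrDr; rewrite RintegralD.
Qed.

Lemma half_fourierZ (k : R) f xi : continuous f -> exp_decay f ->
  half_fourier (fun x => k * f x) xi = k%:C%C * half_fourier f xi.
Proof.
move=> cf df; have [icf isf] := integrable_trig_decay xi cf df.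
rewrite /half_fourier; apply/eqP; rewrite eq_complex/= !mul0r subr0 addr0.
by apply/andP; split; apply/eqP; under eq_Rintegral do rewrite mulrCA; rewrite RintegralZl.
Qed.

Lemma half_fourier_muntz_profile (xi : R) :
  ((1 / 2) -i* xi)%C * half_fourier muntz_profile xi =
  1 - \sum_(j < n) (a j)%:C%C / ((lam j + 1 / 2) -i* xi)%C.
Proof.
rewrite (half_fourier_ode _ is_derive_muntz_profile continuous_muntz_forcing
  exp_decay_muntz_profile exp_decay_muntz_forcing) muntz_profile0; congr (_ + _).
rewrite /muntz_forcing -sumrN.
have ce (p : R) : continuous (fun x => expR (- p * x)).
  by move=> x; exact: is_derive_continuous (is_derive_expc _ _).
have p0 j : 0 < lam j + 1 / 2 by have := lam_gt j; lra.
have de j := exp_decayZ (- a j) (exp_decay_expR (p0 j)).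
have cce j : continuous (fun x => - a j * expR (- (lam j + 1 / 2) * x)).
  by move=> x; apply: cvgM; [exact: cvg_cst|exact: ce].
elim: (index_enum _) => [|j s IH].
  rewrite big_nil /half_fourier; under eq_Rintegral do rewrite big_nil mulr0.
  under [in X in Complex _ X]eq_Rintegral do rewrite big_nil mulr0.
  by rewrite /Rintegral integral0.
under [X in half_fourier X]eq_fun do rewrite big_cons.
rewrite half_fourierD//; last 2 first.
- move=> x; exact: is_derive_continuous (is_derive_bigsum s (fun k =>
    is_derive_scale (- a k) (is_derive_expc (- (lam k + 1 / 2)) x))).
- exact: exp_decay_sum.
rewrite IH big_cons; congr (_ + _); rewrite half_fourierZ//; last exact: exp_decay_expR.
by rewrite half_fourier_expR// rmorphN/= mulNr.
Qed.

End muntz_profile.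

(** * Partial fractions of the Blaschke product *)

Section partial_fractions.
Context (F : fieldType) (n : nat) (p : 'I_n -> F).
Hypothesis p_inj : injective p.

(* Lagrange interpolation at the points [- p j] of the difference between
   numerator and denominator, which has degree less than [n]. *)
Lemma blaschke_partial_fractions (z : F) : (forall j, z + p j != 0) ->
  \prod_(j < n) ((z - p j) / (z + p j)) =
  1 - \sum_(j < n) ((\prod_(l < n) (p j + p l)) / \prod_(l < n | l != j) (p j - p l))
      / (z + p j).
Proof.
move=> zp.
pose D : {poly F} := \prod_(j < n) ('X - (- p j)%:P).
pose Q : {poly F} := \prod_(j < n) ('X - (p j)%:P).
pose A j := (\prod_(l < n) (p j + p l)) / \prod_(l < n | l != j) (p j - p l).
pose L : {poly F} := \sum_(j < n) A j *: \prod_(l < n | l != j) ('X - (- p l)%:P).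
have szI : size (index_enum 'I_n) = n by rewrite [index_enum _]unlock -enumT size_enum_ord.
have szD : size D = n.+1 by rewrite size_prod_XsubC szI.
have szQ : size Q = n.+1 by rewrite size_prod_XsubC szI.
have szL : (size L <= n)%N.
  rewrite (leq_trans (size_sum _ _ _))//; apply/bigmax_leqP => j _.
  rewrite (leq_trans (size_scale_leq _ _))// -big_filter size_prod_XsubC.
  have := count_predC (fun l => l != j) (index_enum 'I_n).
  rewrite -size_filter szI => e.
  rewrite -[X in (_ <= X)%N]e -addn1 leq_add2l.
  by rewrite -has_count; apply/hasP; exists j; rewrite ?mem_index_enum//= negbK.
(* Both polynomials are monic of degree [n], so their leading terms cancel. *)
have szDQ : (size (D - Q)%R <= n)%N.
  have lD : D \is monic by apply: monic_prod => j _; exact: monicXsubC.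
  have lQ : Q \is monic by apply: monic_prod => j _; exact: monicXsubC.
  have : (size (D - Q)%R <= n.+1)%N.
    by rewrite (leq_trans (size_polyD _ _))// size_polyN szD szQ maxnn.
  rewrite leq_eqVlt => /predU1P[sz|//].
  have : lead_coef (D - Q) = 0.
    rewrite lead_coefE sz/= coefB.
    move: (monicP lD) (monicP lQ); rewrite !lead_coefE szD szQ /= => -> ->.
    by rewrite subrr.
  by move/eqP; rewrite lead_coef_eq0 => /eqP DQ0; rewrite DQ0 size_poly0 in sz.
have E : D - Q = L.
  apply/eqP; rewrite -subr_eq0; apply/eqP.
  apply: (@roots_geq_poly_eq0 _ _ [seq - p j | j <- enum 'I_n]).
  (* At [- p j] the polynomial [D] vanishes and [L] keeps only its term [j]. The same power of -1
     comes out of [Q] and of [L], and the denominator of [A j] cancels. *)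
  - apply/allP => x /mapP[j _ ->]; rewrite /root hornerD hornerN hornerD hornerN.
    have -> : D.[- p j] = 0.
      by rewrite horner_prod (bigD1 j)//= hornerXsubC subrr mul0r.
    have -> : Q.[- p j] = \prod_(l < n) (- p j - p l).
      by rewrite horner_prod; apply: eq_bigr => l _; rewrite hornerXsubC.
    have -> : L.[- p j] = A j * \prod_(l < n | l != j) (- p j + p l).
      rewrite horner_sum (bigD1 j)//= [X in _ + X]big1 ?addr0; last first.
        move=> k kj; rewrite hornerZ horner_prod (bigD1 j) 1?eq_sym//=.
        by rewrite hornerXsubC opprK addNr mul0r mulr0.
      rewrite hornerZ horner_prod; congr (_ * _).
      by apply: eq_bigr => l _; rewrite hornerXsubC opprK.
    have nz : \prod_(l < n | l != j) (p j - p l) != 0.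
      by apply/prodf_neq0 => l lj; rewrite subr_eq0; apply: contra lj => /eqP/p_inj->.
    have -> : \prod_(i < n) (- p j - p i) =
        - (p j + p j) * ((-1) ^+ #|[pred l : 'I_n | l != j]| *
          \prod_(i < n | i != j) (p j + p i)).
      rewrite (bigD1 j)//= opprD -prodrN; congr (_ * _).
      by apply: eq_bigr => l _; rewrite opprD.
    have -> : \prod_(i < n | i != j) (- p j + p i) =
        (-1) ^+ #|[pred l : 'I_n | l != j]| * \prod_(i < n | i != j) (p j - p i).
      by rewrite -prodrN; apply: eq_bigr => l _; rewrite opprB addrC.
    rewrite /A [X in X / _](bigD1 j)//=; apply/eqP; field; exact: nz.
  - rewrite map_inj_uniq ?enum_uniq// => i j /oppr_inj; exact: p_inj.
  - by rewrite size_map size_enum_ord (leq_trans (size_polyD _ _))// size_polyN geq_max szDQ szL.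
have Dz : D.[z] = \prod_(j < n) (z + p j).
  by rewrite horner_prod; apply: eq_bigr => j _; rewrite hornerXsubC opprK.
have Dz0 : D.[z] != 0 by rewrite Dz; apply/prodf_neq0 => j _.
have Qz : Q.[z] = \prod_(j < n) (z - p j).
  by rewrite horner_prod; apply: eq_bigr => j _; rewrite hornerXsubC.
rewrite prodf_div -Dz -Qz; apply: (mulIf Dz0); rewrite divfK// mulrBl mul1r.
have -> : Q = D - L by rewrite -E; ring.
rewrite hornerD hornerN; congr (_ - _); rewrite mulr_suml horner_sum.
apply: eq_bigr => j _; rewrite hornerZ -/(A j) -[RHS]mulrA; congr (A j * _).
rewrite [in RHS]Dz [in RHS](bigD1 j)//= mulKf// horner_prod.
by apply: eq_bigr => l _; rewrite hornerXsubC opprK.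
Qed.

End partial_fractions.

Section fourier_muntz.
Context {R : realType} (n : nat) (lam : 'I_n -> R).
Hypothesis lam_inj : injective lam.
Hypothesis lam_gt : forall j, - (1 / 2) < lam j.

(** Taking a factor [i] out of each numerator and denominator turns the quotient into
    [(z - p j) / (z + p j)] at [z = - i xi]. As [p j + p l = lam j + lam l + 1], the residues are
    the Müntz coefficients. *)
Lemma blaschkeE (xi : R) : blaschke (fun j => lam j + 1 / 2) xi =
  1 - \sum_(j < n) (muntz_coef lam j)%:C%C / ((lam j + 1 / 2) -i* xi)%C.
Proof.
pose p j : R[i] := (lam j + 1 / 2)%:C%C.
pose z : R[i] := (0 -i* xi)%C.
have zp j : z + p j = ((lam j + 1 / 2) -i* xi)%C by rewrite /z /p /=; simpc.
have zp0 j : z + p j != 0.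
  by rewrite zp eq_complex/= gt_eqF//; have := lam_gt j; lra.
have p_inj : injective p.
  by move=> i j /(congr1 (@complex.Re R))/= /addIr; exact: lam_inj.
rewrite /blaschke; transitivity (\prod_(j < n) ((z - p j) / (z + p j))).
  apply: eq_bigr => j _; rewrite zp.
  have i0 : (0 +i* 1)%C != 0 :> R[i] by rewrite eq_complex/= oner_eq0 andbF.
  rewrite (_ : (xi -i* _)%C = (0 +i* 1)%C * (z - p j)); last first.
    by rewrite /z /p; apply/eqP; rewrite eq_complex/=; apply/andP; split; apply/eqP; ring.
  rewrite (_ : (xi +i* _)%C = (0 +i* 1)%C * ((lam j + 1 / 2) -i* xi)%C); last first.
    by apply/eqP; rewrite eq_complex/=; apply/andP; split; apply/eqP; ring.
  by rewrite -mulf_div divff// mul1r.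
rewrite blaschke_partial_fractions//; congr (_ - _); apply: eq_bigr => j _.
rewrite zp; congr (_ / _); rewrite /muntz_coef rmorphM fmorphV !rmorph_prod; congr (_ / _).
  by apply: eq_bigr => l _; rewrite /p -rmorphD/=; congr (_%:C)%C; field.
by apply: eq_bigr => l _; rewrite /p -rmorphB/=; congr (_%:C)%C; ring.
Qed.

End fourier_muntz.

(** * Families of norm of order s^(-1/2) *)

Section power_integrals.
Context {R : realType}.
Notation leb := (@lebesgue_measure R).

Lemma measurable_exp_ln (b : R) : measurable_fun [set: R] (fun s : R => expR (b * ln s)).
Proof. by apply: measurableT_comp => //; apply: measurable_funM => //; exact: measurable_ln. Qed.

Lemma is_derive_exp_ln (b s : R) : 0 < s ->
  is_derive s 1 (fun s => expR (b * ln s)) (b * expR ((b - 1) * ln s)).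
Proof.
move=> s0; rewrite mulrBl mul1r expRB lnK// mulrCA mulrC.
rewrite [X in is_derive _ _ _ X](_ : _ = expR (b * ln s) * (b / s)); last by ring.
apply: (is_derive1_comp (f := expR) (g := fun s => b * ln s)).
by apply: is_derive_scale; exact: is_derive1_ln.
Qed.

(* The integrand may blow up at 0, so the integral is exhausted by the compact
   intervals [[t / (i + 2), t]]. *)
Lemma integral_exp_ln_le (b t : R) : -1 < b -> 0 < t ->
  (\int[leb]_(s in `]0%R, t]) (expR (b * ln s))%:E <=
   (expR ((b + 1) * ln t) / (b + 1))%:E)%E.
Proof.
move=> b1 t0; have b10 : 0 < b + 1 by lra.
(* With [i.+2] the left endpoint is strictly below [t] already for [i = 0], as [integral_derivative]
   requires. *)
pose F (i : nat) : set R := `[t / i.+2%:R, t]%classic.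
have tF i : 0 < t / i.+2%:R by rewrite divr_gt0.
have tiF i : t / i.+2%:R < t.
  by rewrite ltr_pdivrMr// ltr_pMr// ltr1n.
have bF : \bigcup_i F i = `]0, t]%classic.
  apply/seteqP; split => [s [i _]|s].
    by rewrite /F/= !in_itv/= => /andP[h ->]; rewrite (lt_le_trans (tF i)).
  rewrite /= in_itv/= => /andP[s0 st]; exists (Num.truncn (t / s)) => //.
  rewrite /F/= in_itv/= st andbT ler_pdivrMr// mulrC -ler_pdivrMr//.
  apply: ltW; apply: (lt_trans (truncnS_gt _)).
  by rewrite ltr_nat.
have ndF : nondecreasing_seq F.
  move=> i j ij; apply/subsetPset => s; rewrite /F/= !in_itv/= => /andP[h ->].
  rewrite andbT; apply: le_trans h; rewrite ler_pM2l// lef_pV2 ?posrE//.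
  by rewrite ler_nat !ltnS.
have cv : (fun i => \int[leb]_(x in F i) (expR (b * ln x))%:E)%E @ \oo -->
    (\int[leb]_(s in `]0%R, t]) (expR (b * ln s))%:E)%E.
  rewrite -bF; apply: ge0_nondecreasing_set_cvg_integral => //.
  - by move=> i; exact: measurable_itv.
  - by move=> i; apply/measurable_EFinP; apply: measurable_funTS; exact: measurable_exp_ln.
rewrite -(cvg_lim (@ereal_hausdorff R) cv); apply: lime_le; first by apply/cvg_ex; eexists; exact: cv.
apply: nearW => i; rewrite /F.
pose G s := (b + 1)^-1 * expR ((b + 1) * ln s).
have -> : (\int[leb]_(s in `[(t / i.+2%:R)%R, t]) (expR (b * ln s))%:E =
    (G t - G (t / i.+2%:R))%:E)%E.
  apply: integral_derivative => // s /andP[s1 _]; have s0 := lt_le_trans (tF i) s1.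
    have := is_derive_scale (b + 1)^-1 (is_derive_exp_ln (b + 1) s0).
    by rewrite mulKf ?gt_eqF// addrK.
  exact: is_derive_continuous (is_derive_exp_ln b s0).
by rewrite lee_fin /G mulrC gerBl mulr_ge0 ?expR_ge0// invr_ge0 ltW.
Qed.

Lemma integrable_exp_ln (b t : R) : -1 < b -> 0 < t ->
  leb.-integrable `]0, t] (EFin \o (fun s => expR (b * ln s))).
Proof.
move=> b1 t0; apply/integrableP; split.
  by apply/measurable_EFinP; apply: measurable_funTS; exact: measurable_exp_ln.
under eq_integral do rewrite /= ger0_norm ?expR_ge0//.
by rewrite (le_lt_trans (integral_exp_ln_le b1 t0))// ltry.
Qed.

End power_integrals.

Section weighted_family.
Context {R : realType} (t : R) (t_gt0 : 0 < t).
Notation leb := (@lebesgue_measure R).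

(* The families below have norm of order [s^(-1/2)]; splitting off [s^(-1/4)]
   leaves two square-integrable factors. *)
Definition quarter (s : R) : R := \1_(`]0, t]) s * expR (- (1 / 4) * ln s).

Lemma measurable_indic_itv (i : interval R) : measurable_fun [set: R] (\1_([set` i]) : R -> R).
Proof. exact: measurable_indic. Qed.

Lemma sqint_quarter : sqint leb quarter.
Proof.
split.
  by apply: measurable_funM; [exact: measurable_indic_itv|exact: measurable_exp_ln].
rewrite (_ : (fun x => _) = (fun s => expR (- (1 / 2) * ln s)) \_ `]0, t]).
  rewrite -restrict_EFin; apply/integrable_restrict => //.
  by rewrite setTI; apply: integrable_exp_ln => //; lra.
apply/funext => s; rewrite /quarter patchE indicE.
case: (_ \in _); last by rewrite mul0r expr0n.
by rewrite [X in X ^+ 2]mul1r expr2 -expRD; congr expR; field.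
Qed.

Context dX (X : measurableType dX) (mu : {sigma_finite_measure set X -> \bar R}).

(** Vanishing outside []0, t]] lets the integral in [s] run over the whole line and gives meaning to
    inner products for every [s]. *)
Record controlled_family (k : R -> X -> R) (C : R) : Prop := ControlledFamily {
  controlled_measurable : measurable_fun [set: measurableTypeR R * X]
    (fun z : measurableTypeR R * X => k z.1 z.2) ;
  controlled_outside : forall s, ~ (0 < s <= t) -> k s = (fun=> 0) ;
  controlled_sqint : forall s, sqint mu (k s) ;
  controlled_inner : forall s, 0 < s -> s <= t -> inner mu (k s) (k s) <= C / s }.

Variables (k : R -> X -> R) (C : R).
Hypothesis hk : controlled_family k C.

Let b (z : measurableTypeR R * X) : R := expR (1 / 4 * ln z.1) * k z.1 z.2.

Lemma controlled_factor s x : k s x = quarter s * b (s, x).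
Proof.
rewrite /b /quarter indicE /=.
have [/[!inE]/= /[!in_itv]/= _|/negP] := boolP (s \in _).
  have e : expR (- (1 / 4) * ln s) * expR (1 / 4 * ln s) = 1 :> R.
    by rewrite -expRD -mulrDl addNr mul0r expR0.
  transitivity (expR (- (1 / 4) * ln s) * expR (1 / 4 * ln s) * k s x); last by ring.
  by rewrite e mul1r.
by rewrite inE/= in_itv/= => /(controlled_outside hk)->; rewrite mulr0 mulr0.
Qed.

(** The squared norm is at most the integral of [s^(1/2) * C / s = C s^(-1/2)] over []0, t]]. *)
Lemma controlled_weighted : sqint (leb \x mu)%E b.
Proof.
have mb : measurable_fun [set: measurableTypeR R * X] b.
  apply: measurable_funM; last exact: controlled_measurable hk.
  by apply: (measurableT_comp (measurable_exp_ln (1 / 4))); exact: measurable_fst.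
have mb2 : measurable_fun [set: measurableTypeR R * X] (fun z => ((b z) ^+ 2)%:E).
  by apply/measurable_EFinP; exact: measurable_funX.
apply: sqintP => //.
rewrite fubini_tonelli1//=; last by move=> z; rewrite lee_fin sqr_ge0.
have C0 : 0 <= C.
  have := controlled_inner hk t_gt0 (lexx t); rewrite ler_pdivlMr//.
  by apply: le_trans; rewrite mulr_ge0 ?inner_ge0// ltW.
apply: (@le_lt_trans _ _ (\int[leb]_(s in `]0%R, t]) (C%:E * (expR (- (1 / 2) * ln s))%:E))%E).
  rewrite [leRHS]integral_mkcond; apply: ge0_le_integral => //.
  - by move=> s _; apply: integral_ge0 => x _; rewrite lee_fin sqr_ge0.
  - by apply: measurable_fun_fubini_tonelli_F => // z; rewrite lee_fin sqr_ge0.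
  - apply: (measurable_restrictT _ _).1 => //; apply: measurable_funeM.
    by apply/measurable_EFinP; apply: measurable_funTS; exact: measurable_exp_ln.
  move=> s _; rewrite /fubini_F /b/= (inner_fin (sqintZ _ (controlled_sqint hk s))).
  have sk := controlled_sqint hk s.
  rewrite innerZl ?innerZr//; last exact: sqintZ.
  rewrite patchE; case: ifPn => [|/negP]; rewrite inE/= in_itv/=.
    move=> /andP[s0 st]; rewrite -EFinM lee_fin.
    have -> : C * expR (- (1 / 2) * ln s) = expR (1 / 4 * ln s) * (expR (1 / 4 * ln s) * (C / s)).
      have e : s = expR (ln s) by rewrite lnK.
      rewrite [in C / s]e -expRN.
      have -> : - (1 / 2) * ln s = 1 / 4 * ln s + 1 / 4 * ln s + - ln s by field.
      by rewrite !expRD; ring.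
    by rewrite !ler_wpM2l ?expR_ge0// (controlled_inner hk).
  move=> /(controlled_outside hk)->.
  rewrite /inner; under eq_Rintegral do rewrite mul0r.
  by rewrite /Rintegral integral0/= !mulr0.
rewrite ge0_integralZl//; last first.
  by apply/measurable_EFinP; apply: measurable_funTS; exact: measurable_exp_ln.
apply: (@le_lt_trans _ _ (C%:E * (expR ((- (1 / 2) + 1) * ln t) / (- (1 / 2) + 1))%:E)%E).
  by apply: lee_wpmul2l; [rewrite lee_fin|apply: integral_exp_ln_le => //; lra].
by rewrite -EFinM ltry.
Qed.

Lemma controlled_sqint_integrated : sqint mu (integrated leb k).
Proof.
exact: (@sqint_integrated _ _ R leb _ X mu k quarter b controlled_factor sqint_quarter
  controlled_weighted).
Qed.

Lemma controlled_inner_sqrB f : sqint mu f ->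
  (inner mu (fun x => f x - integrated leb k x) (fun x => f x - integrated leb k x))%:E =
  ((inner mu f f)%:E - 2%:E * \int[leb]_s (inner mu f (k s))%:E
     + \int[leb]_s \int[leb]_r (inner mu (k s) (k r))%:E)%E.
Proof.
move=> sf; exact: (@inner_sqrB_integrated _ _ R leb _ X mu k quarter b controlled_factor
  sqint_quarter controlled_weighted f sf (controlled_sqint hk)).
Qed.

End weighted_family.

(* Both squared norms are the same expression in the inner products. *)
Lemma controlled_isometry (R : realType) (t C C' : R) (t_gt0 : 0 < t)
  dX (X : measurableType dX) (mu : {sigma_finite_measure set X -> \bar R})
  dY (Y : measurableType dY) (nu : {sigma_finite_measure set Y -> \bar R})
  (k : R -> X -> R) (l : R -> Y -> R) (f : X -> R) (g : Y -> R) :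
  controlled_family t mu k C -> controlled_family t nu l C' ->
  sqint mu f -> sqint nu g ->
  inner mu f f = inner nu g g ->
  (forall s, inner mu f (k s) = inner nu g (l s)) ->
  (forall s r, inner mu (k s) (k r) = inner nu (l s) (l r)) ->
  inner mu (fun x => f x - integrated (@lebesgue_measure R) k x)
           (fun x => f x - integrated (@lebesgue_measure R) k x) =
  inner nu (fun x => g x - integrated (@lebesgue_measure R) l x)
           (fun x => g x - integrated (@lebesgue_measure R) l x).
Proof.
move=> hk hl sf sg fg fk kl; apply: EFin_inj.
rewrite (controlled_inner_sqrB t_gt0 hk sf) (controlled_inner_sqrB t_gt0 hl sg).
rewrite fg; congr (_ - _ * _ + _)%E.
  by apply: eq_integral => s _; rewrite fk.
by apply: eq_integral => s _; apply: eq_integral => r _; rewrite kl.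
Qed.

(** * The Müntz kernel *)

Section muntz_kernel.
Context {R : realType} (n : nat) (lam : 'I_n -> R).
Hypothesis lam_gt : forall j, - (1 / 2) < lam j.
Notation a := (muntz_coef lam).
Notation leb := (@lebesgue_measure R).

(** In logarithmic variables the powers become exponentials, whose measurability in the pair and
    derivative in [s] are immediate. *)
Definition muntz_density (s v : R) : R :=
  expR (- ln s) * \sum_(j < n) a j * expR (lam j * (ln v - ln s)).

Lemma muntz_kernelE (s v : R) : 0 < s -> 0 < v ->
  muntz_kernel lam s v = muntz_density s v.
Proof.
move=> s0 v0; rewrite /muntz_kernel /muntz_density expRN lnK//; congr (_ * _).
apply: eq_bigr => j _; congr (_ * _).
by rewrite /powR gt_eqF ?divr_gt0// ln_div ?posrE.
Qed.

(** The condition [v <= s] is an indicator evaluated at [s - v], so that joint measurability follows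
    by composition. *)
Definition muntz_family (t s v : R) : R :=
  \1_(`]0, t]) s * (\1_(`[0, +oo[) (s - v) * (\1_(`]0, +oo[) v * muntz_density s v)).

Lemma muntz_familyE (t s : R) : 0 < s -> s <= t ->
  muntz_family t s = muntz_kernel lam s \_ `]0, s].
Proof.
move=> s0 st; apply/funext => v; rewrite /muntz_family patchE !indicE !mem_setE.
rewrite !in_itv/= s0 st !andbT subr_ge0 mul1r.
have [v0|v0] := ltP 0 v => /=; last by rewrite mul0r mulr0.
by case: (v <= s); rewrite ?mul0r// !mul1r muntz_kernelE.
Qed.

Lemma muntz_family_outside (t s : R) : ~ (0 < s <= t) -> muntz_family t s = (fun=> 0).
Proof.
move=> /negP/negbTE st; apply/funext => v.
by rewrite /muntz_family indicE mem_setE in_itv/= st mul0r.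
Qed.

Lemma measurable_muntz_family (t : R) :
  measurable_fun [set: measurableTypeR R * measurableTypeR R]
    (fun z : measurableTypeR R * measurableTypeR R => muntz_family t z.1 z.2).
Proof.
have m1 : measurable_fun [set: measurableTypeR R * measurableTypeR R]
    (fun z : measurableTypeR R * measurableTypeR R => z.1 : measurableTypeR R) by exact: measurable_fst.
have m2 : measurable_fun [set: measurableTypeR R * measurableTypeR R]
    (fun z : measurableTypeR R * measurableTypeR R => z.2 : measurableTypeR R) by exact: measurable_snd.
have mln1 := measurableT_comp (@measurable_ln R) m1.
have mln2 := measurableT_comp (@measurable_ln R) m2.
apply: measurable_funM.
  exact: (measurableT_comp (measurable_indic_itv _) m1).
apply: measurable_funM.
  apply: (measurableT_comp (measurable_indic_itv _)).
  exact: (measurable_funB m1 m2).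
apply: measurable_funM.
  exact: (measurableT_comp (measurable_indic_itv _) m2).
apply: measurable_funM.
  by apply: measurableT_comp => //; exact: measurableT_comp.
apply: measurable_sum => j; apply: measurable_funM => //.
apply: measurableT_comp => //; apply: measurable_funM => //.
exact: (measurable_funB mln2 mln1).
Qed.

(** A common lower exponent: for [v <= s] every [(v / s)^(lam j)] is at most [(v / s)^m], which is
    square-integrable near [v = 0]. *)
Lemma muntz_exponent_gap : exists m, - (1 / 2) < m /\ forall j, m <= lam j.
Proof.
exists (\big[Num.min/0]_(j < n) lam j); split; last by move=> j; exact: bigmin_le.
by apply/bigmin_gtP; split => //; lra.
Qed.

Lemma controlled_muntz_family (t : R) : 0 < t ->
  exists C, controlled_family t leb (muntz_family t) C.
Proof.
move=> t0; have [m [m0 mlam]] := muntz_exponent_gap.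
pose A := \sum_(j < n) `|a j|.
have A0 : 0 <= A by apply: sumr_ge0.
have mk s : measurable_fun [set: R] (muntz_family t s).
  exact: (measurableT_comp (measurable_muntz_family t) (pair1_measurable (s : measurableTypeR R))).
have bound s : 0 < s -> s <= t ->
    (\int[leb]_v ((muntz_family t s v) ^+ 2)%:E <= (A ^+ 2 / (2 * m + 1) / s)%:E)%E.
  move=> s0 st.
  (* The square of [A s^(-1) (v / s)^m] is [c v^(2 m)], and its integral over []0, s]] is
     [A^2 / ((2 m + 1) s)]. *)
  pose c := A ^+ 2 * expR (- ((2 * m + 2) * ln s)).
  have c0 : 0 <= c by rewrite mulr_ge0 ?expR_ge0// sqr_ge0.
  apply: (@le_trans _ _ (\int[leb]_(v in `]0%R, s]) (c%:E * (expR (2 * m * ln v))%:E))%E).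
    rewrite [leRHS]integral_mkcond; apply: ge0_le_integral => //.
    - by move=> v _; rewrite lee_fin sqr_ge0.
    - by apply/measurable_EFinP; exact: (measurable_funX 2 (mk s)).
    - apply: (measurable_restrictT _ _).1 => //; apply: measurable_funeM.
      by apply/measurable_EFinP; apply: measurable_funTS; exact: measurable_exp_ln.
    move=> v _; rewrite muntz_familyE// !patchE; case: ifPn; last first.
      by rewrite expr0n.
    rewrite inE/= in_itv/= => /andP[v0 vs]; rewrite muntz_kernelE//.
    rewrite -EFinM lee_fin -(real_normK (num_real (muntz_density s v))).
    have -> : c * expR (2 * m * ln v) = (A * expR (m * ln v - (m + 1) * ln s)) ^+ 2.
      rewrite /c exprMn -mulrA -expRD (expr2 (expR _)) -expRD; congr (_ * expR _); ring.
    have lvs : ln v - ln s <= 0 by rewrite subr_le0 ler_ln ?posrE.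
    rewrite ler_pXn2r ?nnegrE ?mulr_ge0 ?expR_ge0//.
    rewrite /muntz_density normrM ger0_norm ?expR_ge0//.
    have -> : A * expR (m * ln v - (m + 1) * ln s) =
        expR (- ln s) * (A * expR (m * (ln v - ln s))).
      rewrite mulrCA -expRD; congr (_ * expR _); ring.
    rewrite ler_wpM2l ?expR_ge0// (le_trans (ler_norm_sum _ _ _))// /A mulr_suml.
    apply: ler_sum => j _; rewrite normrM ler_wpM2l// ger0_norm ?expR_ge0// ler_expR.
    by rewrite ler_wnM2r.
  rewrite ge0_integralZl//; last first.
    by apply/measurable_EFinP; apply: measurable_funTS; exact: measurable_exp_ln.
  apply: (@le_trans _ _ (c%:E * (expR ((2 * m + 1) * ln s) / (2 * m + 1))%:E)%E).
    by apply: lee_wpmul2l; [rewrite lee_fin|apply: integral_exp_ln_le => //; lra].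
  rewrite -EFinM lee_fin /c.
  have -> : s^-1 = expR (- ln s) by rewrite expRN lnK.
  have -> : - ln s = - ((2 * m + 2) * ln s) + (2 * m + 1) * ln s by ring.
  rewrite expRD le_eqVlt; apply/orP; left; apply/eqP; ring.
exists (A ^+ 2 / (2 * m + 1)).
have sk s : sqint leb (muntz_family t s).
  have [/andP[s0 st]|/negP st] := boolP (0 < s <= t).
    by apply: sqintP; [exact: mk|rewrite (le_lt_trans (bound s s0 st))// ltry].
  by rewrite muntz_family_outside//; exact: sqint0.
split => //.
- exact: measurable_muntz_family.
- by move=> s; exact: muntz_family_outside.
- by move=> s s0 st; rewrite -lee_fin -inner_fin//; exact: bound.
Qed.

(** Substituting [y = ln s - ln v] turns [(v / s)^(lam j) ds / s] into [e^(- lam j y) dy]. *)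
Lemma integrated_muntz_family (t v : R) : 0 < v -> v <= t ->
  integrated leb (muntz_family t) v = \sum_(j < n) a j * exp_primitive (lam j) (ln t - ln v).
Proof.
move=> v0 vt; rewrite /integrated.
have -> : (fun s => muntz_family t s v) = (muntz_density ^~ v) \_ `[v, t].
  apply/funext => s; rewrite /muntz_family patchE !indicE !mem_setE !in_itv/= v0 !andbT mul1r.
  rewrite subr_ge0; have [vs|_] := leP v s; last by rewrite mul0r mulr0.
  by rewrite (lt_le_trans v0 vs)/=; case: (s <= t); rewrite ?mul1r ?mul0r.
rewrite -Rintegral_mkcond.
move: vt; rewrite le_eqVlt => /predU1P[<-|vt].
  rewrite set_itv1 Rintegral_set1 big1// => j _.
  by rewrite subrr exp_primitive0 mulr0.
pose F s := \sum_(j < n) a j * exp_primitive (lam j) (ln s - ln v).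
have dF s : v <= s <= t -> is_derive s 1 F (muntz_density s v).
  move=> /andP[vs _]; have s0 := lt_le_trans v0 vs.
  rewrite [X in is_derive _ _ _ X](_ : _ =
      \sum_(j < n) a j * (expR (- lam j * (ln s - ln v)) * (s^-1 + 0))); last first.
    rewrite /muntz_density expRN lnK// mulr_sumr; apply: eq_bigr => j _.
    by rewrite addr0 (_ : - lam j * _ = lam j * (ln v - ln s)); ring.
  apply: is_derive_bigsum => j; apply: is_derive_scale.
  apply: (is_derive1_comp (f := exp_primitive (lam j)) (g := fun s => ln s - ln v)).
    exact: is_derive_exp_primitive.
  by apply: is_derive_add; exact: is_derive1_ln.
have cf s : v <= s <= t -> {for s, continuous (muntz_density ^~ v)}.
  move=> /andP[vs _]; have s0 := lt_le_trans v0 vs.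
  have dln := is_derive_continuous (is_derive1_ln s0).
  have cexp (c e : R) : {for s, continuous (fun s => expR (c * (e - ln s)))}.
    apply: continuous_comp; last exact: continuous_expR.
    by apply: cvgM; [exact: cvg_cst|apply: cvgB; [exact: cvg_cst|exact: dln]].
  apply: cvgM.
    apply: continuous_comp; last exact: continuous_expR.
    by apply: cvgN; exact: dln.
  elim: (index_enum _) => [|j l IH].
    by under eq_fun do rewrite big_nil; rewrite big_nil; exact: cvg_cst.
  under eq_fun do rewrite big_cons; rewrite big_cons.
  by apply: cvgD => //; apply: cvgM; [exact: cvg_cst|exact: cexp].
rewrite /Rintegral (integral_derivative vt dF cf)/= /F.
rewrite [X in _ - X]big1 ?subr0// => j _.
by rewrite subrr exp_primitive0 mulr0.
Qed.

Lemma integrated_muntz_family0 (t v : R) : v <= 0 \/ t < v ->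
  integrated leb (muntz_family t) v = 0.
Proof.
move=> vt; rewrite /integrated (_ : (fun s => _) = (fun=> 0)).
  by rewrite /Rintegral integral0.
apply/funext => s; rewrite /muntz_family !indicE !mem_setE !in_itv/= !andbT subr_ge0.
case: vt => [v0|tv]; first by rewrite (ltNge 0 v) v0/= !(mul0r, mulr0).
have [st|_] := leP s t; last by rewrite andbF mul0r.
by rewrite leNgt (le_lt_trans st tv)/= !(mul0r, mulr0).
Qed.

End muntz_kernel.

(** * Step approximations of the moving average kernel *)

Lemma dominated_cvg0 (R : realType) (D : set R) (f_ : nat -> R -> R) (g : R -> R) :
  measurable D -> (forall k, measurable_fun [set: R] (f_ k)) ->
  (@lebesgue_measure R).-integrable D (EFin \o g) ->
  (forall x, D x -> (fun k => f_ k x) @ \oo --> (0 : R)) ->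
  (forall k x, D x -> `|f_ k x| <= g x) ->
  (fun k => \int[lebesgue_measure]_(x in D) (f_ k x)%:E)%E @ \oo --> 0%E.
Proof.
move=> mD mf_ ig cf fg.
have m_ k : measurable_fun D (EFin \o f_ k).
  by apply/measurable_EFinP; exact: measurable_funTS.
have m0 : measurable_fun D (cst 0 : R -> \bar R) by exact: measurable_cst.
have h1 : {ae @lebesgue_measure R, forall x, D x ->
    (fun k => (EFin \o f_ k) x) @ \oo --> (cst 0%E : R -> \bar R) x}.
  by apply: aeW => x Dx; apply/cvg_EFin; [exact: nearW|exact: cf].
have h2 : {ae @lebesgue_measure R, forall x k, D x -> (`|(EFin \o f_ k) x| <= (EFin \o g) x)%E}.
  by apply: aeW => x k Dx; rewrite /= lee_fin fg.
have [_ _] := @dominated_convergence _ _ _ (@lebesgue_measure R) D mD _ _ (EFin \o g) m_ m0 h1 ig h2.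
by rewrite integral0.
Qed.

(* Also valid for [v <= 0], where both [Num.sqrt v] and its inverse are 0. *)
Lemma invr_sqrtE (R : realType) (v : R) :
  (Num.sqrt v)^-1 = \1_(`]0, +oo[) v * expR (- (1 / 2) * ln v).
Proof.
rewrite indicE mem_setE in_itv/= andbT.
have [v0|v0] := ltP 0 v; last by rewrite ler0_sqrtr// invr0 mul0r.
have {1}-> : v = expR (1 / 2 * ln v) ^+ 2.
  by rewrite expr2 -expRD -mulrDl -splitr mul1r lnK.
by rewrite sqrtr_sqr ger0_norm ?expR_ge0// mulNr expRN [RHS]mul1r.
Qed.

Section riemann_steps.
Context {R : realType}.
Notation leb := (@lebesgue_measure R).
Variables (psi : R -> R) (C c u : R).
Hypothesis cpsi : continuous psi.
Hypothesis c_gt0 : 0 < c.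
Hypothesis bpsi : exp_bounded psi C c.

(** There are [(k + 1)^2] cells of width [1 / (k + 1)] going backwards from [u]: the mesh tends to 0
    while the covered length [k + 1] tends to infinity. *)
Definition riemann_steps (k : nat) : seq (R * R * R) :=
  [seq (u - i.+1%:R / k.+1%:R, u - i%:R / k.+1%:R, psi (i%:R / k.+1%:R))
     | i <- iota 0 (k.+1 * k.+1)].

Lemma step_in_riemann_steps k : step_in `]-oo, u] (riemann_steps k).
Proof.
move=> z /mapP[i _ ->]/=; split.
  by rewrite lerB// ler_pM2r ?invr_gt0// ler_nat.
move=> r; rewrite /= !in_itv/= => /andP[_ h]; apply: (le_trans h).
by rewrite gerBl divr_ge0.
Qed.

Lemma step_fun_riemann_steps k r : r <= u ->
  let i := Num.truncn ((u - r) * k.+1%:R) in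
  step_fun (riemann_steps k) r =
  if (i < k.+1 * k.+1)%N then psi (i%:R / k.+1%:R) else 0.
Proof.
move=> ru i; have k0 : 0 < k.+1%:R :> R by [].
have x0 : 0 <= (u - r) * k.+1%:R by rewrite mulr_ge0// subr_ge0.
have ind j : \1_(`](u - j.+1%:R / k.+1%:R), (u - j%:R / k.+1%:R)]) r = (j == i)%:R :> R.
  rewrite indic_ocE eq_sym /i truncn_eq//; congr (nat_of_bool _)%:R.
  rewrite andbC; congr (_ && _).
    by rewrite lerBrDr -lerBrDl ler_pdivrMr.
  by rewrite ltrBlDr -ltrBlDl ltr_pdivlMr.
rewrite /riemann_steps; move: (k.+1 * k.+1)%N => N.
rewrite /step_fun big_map/=; under eq_bigr do rewrite ind.
case: ifPn => iN.
  rewrite (bigD1_seq i)/= ?iota_uniq ?mem_iota// eqxx mulr1 big1 ?addr0// => j /negbTE->.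
  by rewrite mulr0.
rewrite big_seq big1// => j; rewrite mem_iota add0n/= => jN.
by case: eqP iN => [<-|_ _]; [rewrite jN|rewrite mulr0].
Qed.

Let C_ge0 : 0 <= C.
Proof. by have := bpsi (lexx 0); rewrite mulr0 expR0 mulr1; exact: le_trans. Qed.

(** The sampling point is less than one cell, hence at most 1, below [u - r]; this costs the factor
    [e^c] uniformly in [k]. *)
Lemma riemann_steps_bounded k r : r <= u ->
  `|step_fun (riemann_steps k) r| <= C * expR c * expR (- c * (u - r)).
Proof.
move=> ru; rewrite step_fun_riemann_steps//.
have k0 : 0 < k.+1%:R :> R by [].
case: ifPn => _; last by rewrite normr0 !mulr_ge0 ?expR_ge0.
set i := Num.truncn _.
have i0 : 0 <= i%:R / k.+1%:R :> R by rewrite divr_ge0.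
apply: (le_trans (bpsi i0)); rewrite -mulrA ler_wpM2l// -expRD ler_expR.
have h : u - r <= i%:R / k.+1%:R + 1.
  have := ltW (truncnS_gt ((u - r) * k.+1%:R)); rewrite -/i -ler_pdivlMr// => /le_trans; apply.
  rewrite -natr1 mulrDl lerD2l div1r invf_le1// ler1n//.
rewrite -subr_ge0 (_ : _ - _ = c * (i%:R / k.+1%:R + 1 - (u - r))); last by ring.
by rewrite mulr_ge0 ?subr_ge0// ltW.
Qed.

Lemma cvg_riemann_steps r : r <= u ->
  (fun k => step_fun (riemann_steps k) r) @ \oo --> psi (u - r).
Proof.
move=> ru; set x := u - r; have x0 : 0 <= x by rewrite subr_ge0.
have c1 : (fun k : nat => (Num.truncn (x * k.+1%:R))%:R / k.+1%:R : R) @ \oo --> x.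
  apply: (squeeze_cvgr (f := fun k : nat => x - k.+1%:R^-1) (h := fun=> x)).
  - near=> k; have k0 : 0 < k.+1%:R :> R by [].
    have /andP[h1 h2] := truncn_itv (mulr_ge0 x0 (ltW k0)).
    rewrite ler_pdivrMr// h1 andbT lerBlDr -[X in _ <= _ + X]div1r -mulrDl ler_pdivlMr//.
    by rewrite natr1 ltW.
  - rewrite -[X in _ --> X]subr0; apply: cvgB; first exact: cvg_cst.
    exact: cvg_harmonic.
  - exact: cvg_cst.
have c2 : (fun k : nat => psi ((Num.truncn (x * k.+1%:R))%:R / k.+1%:R)) @ \oo --> psi x.
  exact: (cvg_comp _ _ c1 (@cpsi x)).
apply: cvg_trans c2; apply: near_eq_cvg; near=> k.
rewrite step_fun_riemann_steps// ifT//.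
have k0 : 0 < k.+1%:R :> R by [].
rewrite truncn_lt_nat ?mulr_ge0// natrM ltr_pM2r//.
(* From this rank on [x < k + 1], so [r] lies in the covered range. *)
near: k; exists (Num.truncn x) => // k /= xk.
by apply: (lt_le_trans (truncnS_gt x)); rewrite ler_nat.
Unshelve. all: by end_near. Qed.

Let M : R := (C + C * expR c) ^+ 2.

(** A bound independent of [k], which provides the dominating function in both convergences
    below. *)
Lemma riemann_steps_error k r : r <= u ->
  (psi (u - r) - step_fun (riemann_steps k) r) ^+ 2 <= M * expR (- (2 * c) * (u - r)).
Proof.
move=> ru; have ur : 0 <= u - r by rewrite subr_ge0.
have -> : - (2 * c) * (u - r) = - c * (u - r) + - c * (u - r) by ring.
rewrite expRD /M -(real_normK (num_real (psi _ - _))) -expr2 -exprMn.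
rewrite ler_pXn2r ?nnegrE ?mulr_ge0 ?expR_ge0 ?addr_ge0 ?mulr_ge0 ?expR_ge0//.
rewrite (le_trans (ler_normB _ _))// mulrDl lerD//; first exact: bpsi.
exact: riemann_steps_bounded.
Qed.

Lemma cvg_riemann_steps_error r : r <= u ->
  (fun k => (psi (u - r) - step_fun (riemann_steps k) r) ^+ 2) @ \oo --> (0 : R).
Proof.
move=> ru; have h : (fun k => psi (u - r) - step_fun (riemann_steps k) r) @ \oo -->
    psi (u - r) - psi (u - r).
  by apply: cvgB; [exact: cvg_cst|exact: cvg_riemann_steps].
rewrite [in X in _ --> X](_ : 0 = (psi (u - r) - psi (u - r)) * (psi (u - r) - psi (u - r))).
  by under eq_fun do rewrite expr2; apply: cvgM.
by rewrite subrr mul0r.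
Qed.

Let measurable_psi : measurable_fun [set: R] psi.
Proof. exact: continuous_measurable_fun. Qed.

Let measurable_step g : measurable_fun [set: R] (@step_fun R g).
Proof. exact: sqint_measurable (sqint_step_fun g). Qed.

Lemma cvg_moving_average_steps :
  (fun k => \int[leb]_(r in `]-oo, u])
     (((psi \_ `]0, +oo[) (u - r) - step_fun (riemann_steps k) r) ^+ 2)%:E)%E @ \oo --> 0%E.
Proof.
pose f_ k r := ((psi \_ `]0, +oo[) (u - r) - step_fun (riemann_steps k) r) ^+ 2.
have mu_ : measurable_fun [set: R] (fun r : R => u - r).
  by apply: measurable_funB.
have mf_ k : measurable_fun [set: R] (f_ k).
  apply: measurable_funX; apply: measurable_funB => //.
  apply: (measurableT_comp _ mu_); apply: (measurable_restrictT _ _).1 => //.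
  exact: measurable_funTS.
(* At [r = u] the restricted kernel is 0 while the step function is [psi 0]; removing this point
   lets the pointwise limit hold everywhere. *)
have -> : (fun k => \int[leb]_(r in `]-oo, u]) (f_ k r)%:E)%E =
    (fun k => \int[leb]_(r in `]-oo, u[) (f_ k r)%:E)%E.
  apply/funext => k; rewrite [RHS]integral_itv_bndo_bndc//.
  by apply/measurable_EFinP; exact: measurable_funTS.
pose g r := (M * expR (- (2 * c) * (u - r)))%:E.
have M0 : 0 <= M by exact: sqr_ge0.
have mg : measurable_fun [set: R] g.
  apply/measurable_EFinP; apply: measurable_funM => //.
  by apply: measurableT_comp => //; apply: measurable_funM.
have ig : leb.-integrable `]-oo, u[ g.
  apply: (@integrableS _ _ _ leb `]-oo, u]) => //.
    by move=> r; rewrite /= !in_itv/=; exact: ltW.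
  apply/integrableP; split; first exact: measurable_funTS.
  have -> : (fun r => `|g r|%E) = g.
    by apply/funext => r; rewrite gee0_abs// lee_fin mulr_ge0// expR_ge0.
  rewrite /g.
  rewrite -(opprK u) ge0_integration_by_substitutionNy.
  - under eq_integral do rewrite /= !opprK mulrDr expRD mulrA.
    by rewrite integral_expRN; [exact: ltry|rewrite mulr_ge0 ?expR_ge0|rewrite mulr_gt0].
  - apply: continuous_subspaceT => x; apply: cvgM; first exact: cvg_cst.
    apply: continuous_comp; last exact: continuous_expR.
    by apply: cvgM; [exact: cvg_cst|apply: cvgB; [exact: cvg_cst|exact: cvg_id]].
  - by move=> x _; rewrite mulr_ge0 ?expR_ge0.
have fE k r : r < u -> f_ k r = (psi (u - r) - step_fun (riemann_steps k) r) ^+ 2.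
  by move=> ru; rewrite /f_ patchE ifT// inE/= in_itv/= andbT subr_gt0.
apply: (@dominated_cvg0 _ _ _ (fun r => M * expR (- (2 * c) * (u - r)))) => //.
- move=> r; rewrite /= in_itv/= => ru; under eq_fun do rewrite fE//.
  exact: cvg_riemann_steps_error (ltW ru).
- move=> k r; rewrite /= in_itv/= => ru.
  by rewrite fE// ger0_norm ?sqr_ge0// riemann_steps_error// ltW.
Qed.

(** This is the previous error in the variable [v = e^r], where [dr = dv / v]. The dominating
    function is a multiple of [v^(2 c - 1)], integrable at 0 because [c > 0]. *)
Lemma cvg_lamperti_steps :
  (fun k => \int[leb]_v ((\1_(`]0%R, expR u]) v * ((Num.sqrt v)^-1 *
      (psi (u - ln v) - step_fun (riemann_steps k) (ln v)))) ^+ 2)%:E)%E @ \oo --> 0%E.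
Proof.
pose f_ k v := (\1_(`]0%R, expR u]) v * ((Num.sqrt v)^-1 *
      (psi (u - ln v) - step_fun (riemann_steps k) (ln v)))) ^+ 2.
have fE k v : 0 < v -> v <= expR u ->
    f_ k v = v^-1 * (psi (u - ln v) - step_fun (riemann_steps k) (ln v)) ^+ 2.
  move=> v0 vu; rewrite /f_ indic_ocE v0 vu mul1r exprMn exprVn sqr_sqrtr//.
  exact: ltW.
have f0 k v : ~ (0 < v <= expR u) -> f_ k v = 0.
  by move=> /negP/negbTE vu; rewrite /f_ indic_ocE vu mul0r expr0n.
have -> : (fun k => \int[leb]_v (f_ k v)%:E)%E =
    (fun k => \int[leb]_(v in `]0%R, expR u]) (f_ k v)%:E)%E.
  apply/funext => k; rewrite [RHS]integral_mkcond; apply: eq_integral => v _.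
  by rewrite patchE; case: ifPn => // /negP; rewrite inE/= in_itv/= => /f0->.
pose g v := M * expR (- (2 * c) * u) * expR ((2 * c - 1) * ln v).
have M0 : 0 <= M by exact: sqr_ge0.
have ig : leb.-integrable `]0, expR u] (EFin \o g).
  by apply: integrable_scaler => //; apply: integrable_exp_ln => //; rewrite ?expR_gt0//; have := c_gt0; lra.
have mln := @measurable_ln R.
have ms : measurable_fun [set: R] (fun v : R => (Num.sqrt v)^-1).
  under eq_fun do rewrite invr_sqrtE.
  by apply: measurable_funM; [exact: measurable_indic_itv|exact: measurable_exp_ln].
have mf_ k : measurable_fun [set: R] (f_ k).
  apply: measurable_funX; apply: measurable_funM.
    exact: measurable_indic_itv.
  apply: measurable_funM => //; apply: measurable_funB.
    by apply: measurableT_comp => //; apply: measurable_funB.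
  exact: measurableT_comp.
apply: (dominated_cvg0 _ mf_ ig) => //.
- move=> v; rewrite /= in_itv/= => /andP[v0 vu]; under eq_fun do rewrite fE//.
  have lvu : ln v <= u by rewrite -ler_expR lnK.
  by rewrite -(mulr0 v^-1); apply: cvgMl_tmp; exact: cvg_riemann_steps_error.
- move=> k v; rewrite /= in_itv/= => /andP[v0 vu].
  have lvu : ln v <= u by rewrite -ler_expR lnK.
  rewrite fE// (ger0_norm (mulr_ge0 _ (sqr_ge0 _))) ?invr_ge0 ?(ltW v0)//.
  have -> : g v = v^-1 * (M * expR (- (2 * c) * (u - ln v))).
    have -> : v^-1 = expR (- ln v) by rewrite expRN lnK.
    rewrite /g; have -> : (2 * c - 1) * ln v = - ln v + 2 * c * ln v by ring.
    have -> : - (2 * c) * (u - ln v) = - (2 * c) * u + 2 * c * ln v by ring.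
    by rewrite !expRD; ring.
  by rewrite ler_wpM2l ?invr_ge0 ?(ltW v0)// riemann_steps_error.
Qed.

End riemann_steps.

(** * The stationary transform *)

Section lamperti_transform.
Context (R : realType) (d : measure_display) (T : measurableType d) (P : probability T R)
  (n : nat) (lam : 'I_n -> R).
Hypothesis lam_gt : forall j, - (1 / 2) < lam j.
Variables B W : R -> {RV P >-> R}.
Hypothesis B_dist : forall u v, 0 <= u -> 0 <= v ->
  'E_P[fun w => ((B u w - B v w) ^+ 2)%R]%E = `|u - v|%:E.
Hypothesis B0 : {ae P, forall w, B 0 w = 0}.
Variable K : R -> T -> R.
Hypothesis hK : inner_integral_process B lam K.
Hypothesis hWB : lamperti_brownian_motion B W.
Notation leb := (@lebesgue_measure R).

Definition cut_process (t s : R) (w : T) : R := ((K ^~ w) \_ `]0, t]) s.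

Lemma wiener_pair_cut_process (t s : R) :
  wiener_pair B (muntz_family lam t s) (cut_process t s).
Proof.
have [/andP[s0 st]|/negP st] := boolP (0 < s <= t).
  have -> : cut_process t s = K s.
    by apply/funext => w; rewrite /cut_process patchE ifT// inE/= in_itv/= s0.
  rewrite muntz_familyE//; apply: (is_wiener_integral_pair B_dist) => //.
    by move=> x; rewrite /= in_itv/= => /andP[/ltW].
  by have [_] := hK; apply.
rewrite muntz_family_outside//.
have -> : cut_process t s = (fun=> 0); last exact: wiener_pair0.
by apply/funext => w; rewrite /cut_process patchE ifF//; apply/negP; rewrite inE/= in_itv.
Qed.

(** The norm bound passes from the kernels to the process through the isometry, with the same
    constant. *)
Lemma controlled_cut_process (t C : R) : controlled_family t leb (muntz_family lam t) C ->
  controlled_family t P (cut_process t) C.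
Proof.
move=> hC; split.
- pose D := (`]0, t] `*` [set: T]) : set (measurableTypeR R * T).
  have mD : measurable D by apply: measurableX => //; exact: measurable_itv.
  rewrite (_ : (fun z => _) = (fun z : measurableTypeR R * T => K z.1 z.2) \_ D).
    apply: (measurable_restrictT _ mD).1.
    have [mK _] := hK; apply: measurable_funS mK.
      have -> : [set z : measurableTypeR R * T | 0 < z.1] =
          ((`]0, +oo[ : set R) `*` [set: T]) :> set (measurableTypeR R * T).
        apply/seteqP; split => -[x y] /=; last by move=> [+ _]; rewrite in_itv/= andbT.
        by move=> x0; split => //; rewrite in_itv/= x0.
      by apply: measurableX => //; exact: measurable_itv.
    by move=> [x y]; rewrite /D/= => -[+ _]; rewrite in_itv/= => /andP[].
  apply/funext => -[s w]; rewrite /cut_process !patchE /D.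
  by congr (if _ then _ else _); apply/idP/idP; rewrite !inE/= => //; case.
- move=> s st; apply/funext => w; rewrite /cut_process patchE ifF//.
  by apply/negP; rewrite inE/= in_itv.
- by move=> s; have [] := wiener_pair_cut_process t s.
- move=> s s0 st; rewrite (wiener_pair_inner B_dist (wiener_pair_cut_process t s)
    (wiener_pair_cut_process t s)).
  exact: controlled_inner hC s s0 st.
Qed.

Lemma muntz_transformE (t : R) w :
  muntz_transform B K t w = B t w - integrated leb (cut_process t) w.
Proof. by rewrite /muntz_transform Rintegral_mkcond. Qed.

Lemma measurable_stationary_transform (u : R) :
  measurable_fun [set: T] (stationary_transform B K u).
Proof.
have t0 := expR_gt0 u.
have [C /controlled_cut_process hC] := controlled_muntz_family lam_gt t0.
rewrite /stationary_transform; apply: measurable_funM => //.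
rewrite (funext (muntz_transformE (expR u))); apply: measurable_funB => //.
exact: sqint_measurable (controlled_sqint_integrated t0 hC).
Qed.

(** The factors [e^(u/2)], [v^(-1/2)] and [e^(-(u - ln v)/2)] have product 1. *)
Lemma muntz_profile_integrated (u v : R) : 0 < v -> v <= expR u ->
  1 - integrated leb (muntz_family lam (expR u)) v =
  expR (u / 2) * ((Num.sqrt v)^-1 * muntz_profile lam (u - ln v)).
Proof.
move=> v0 vu; rewrite integrated_muntz_family// expRK /muntz_profile invr_sqrtE.
rewrite indicE mem_setE in_itv/= v0 [1%:R * _]mul1r.
set X := 1 - _.
have e : expR (u / 2) * expR (- (1 / 2) * ln v) * expR (- (1 / 2) * (u - ln v)) = 1.
  by rewrite -!expRD -[RHS]expR0; congr expR; field.
transitivity (expR (u / 2) * expR (- (1 / 2) * ln v) * expR (- (1 / 2) * (u - ln v)) * X).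
  by rewrite e mul1r.
ring.
Qed.

(** Up to the factor [e^(-u/2)], the error is [zeta] minus the integrated process, where
    [zeta = B_t - e^(u/2) int g dW] with [t = e^u] belongs to a Wiener pair. [controlled_isometry]
    then replaces its norm by that of the explicit deterministic function. *)
Lemma stationary_transform_error (u : R) g : step_in `]-oo, u] g ->
  'E_P[fun w => ((stationary_transform B K u w - step_integral W g w) ^+ 2)%R]%E =
  (\int[leb]_v ((\1_(`]0%R, expR u]) v * ((Num.sqrt v)^-1 *
      (muntz_profile lam (u - ln v) - step_fun g (ln v)))) ^+ 2)%:E)%E.
Proof.
move=> gu; pose t := expR u; have t0 : 0 < t := expR_gt0 u.
have [C hl] := controlled_muntz_family lam_gt t0; have hk := controlled_cut_process hl.
have wp := wiener_pairD B_dist (- expR (u / 2))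
  (wiener_pair_lamperti_step B_dist hWB gu) (wiener_pair_point B_dist (ltW t0) B0).
move: wp; set f := (X in wiener_pair _ X _); set zeta := (X in wiener_pair _ _ X) => wp.
have [sf szeta _] := wp.
have := controlled_isometry t0 hk hl szeta sf (wiener_pair_inner B_dist wp wp)
  (fun s => wiener_pair_inner B_dist wp (wiener_pair_cut_process t s))
  (fun s r => wiener_pair_inner B_dist (wiener_pair_cut_process t s) (wiener_pair_cut_process t r)).
set S := (X in inner P X _); set D := (X in inner leb X _) => iso.
have sS : sqint P S by apply: sqintB => //; exact: controlled_sqint_integrated hk.
have sD : sqint leb D by apply: sqintB => //; exact: controlled_sqint_integrated hl.
have SE w : stationary_transform B K u w - step_integral W g w = expR (- u / 2) * S w.
  rewrite /stationary_transform /S /zeta -/t.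
  have e : expR (- u / 2) * expR (u / 2) = 1 by rewrite -expRD mulNr addNr expR0.
  transitivity (expR (- u / 2) * muntz_transform B K t w
    - expR (- u / 2) * expR (u / 2) * step_integral W g w); first by rewrite e mul1r.
  by rewrite muntz_transformE; ring.
have DE v : \1_(`]0, expR u]) v * ((Num.sqrt v)^-1 *
      (muntz_profile lam (u - ln v) - step_fun g (ln v))) = expR (- u / 2) * D v.
  have e : expR (- u / 2) * expR (u / 2) = 1 by rewrite -expRD mulNr addNr expR0.
  rewrite /D /f indic_ocE -/t; set I := (X in _ = _ * (_ - X)).
  (* For [v <= 0] the inverse square root vanishes; beyond [e^u] the steps vanish, since they live
     in []-oo, u]]. *)
  have [v0|v0] := ltP 0 v; last first.
    have -> : I = 0 by apply: integrated_muntz_family0; left.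
    by rewrite ler0_sqrtr// invr0 /=; ring.
  have [vt|tv] := leP v t.
    have h : 1 - I = expR (u / 2) * ((Num.sqrt v)^-1 * muntz_profile lam (u - ln v)).
      exact: muntz_profile_integrated.
    transitivity (expR (- u / 2) * (1 - I - expR (u / 2) * ((Num.sqrt v)^-1 * step_fun g (ln v))));
      last by rewrite /=; ring.
    by rewrite h -[in RHS]mulrBr [RHS]mulrA e -mulrBr /= !mul1r.
  have -> : I = 0 by apply: integrated_muntz_family0; right.
  rewrite (step_fun_outside gu); first by rewrite /=; ring.
  by rewrite /= in_itv/= -ler_expR lnK// leNgt tv.
rewrite unlock; under eq_integral do rewrite SE.
under [RHS]eq_integral do rewrite DE.
rewrite (inner_fin (sqintZ _ sS)) (inner_fin (sqintZ _ sD)).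
by rewrite !innerZl ?innerZr ?iso//; exact: sqintZ.
Qed.

Lemma is_wiener_integral_stationary (u : R) :
  is_wiener_integral W `]-oo, u] (fun v => (muntz_profile lam \_ `]0, +oo[) (u - v))
    (stationary_transform B K u).
Proof.
have cphi := @continuous_muntz_profile R n lam.
have [C [c [c0 bphi]]] := exp_decay_muntz_profile lam_gt.
split.
- apply: measurable_funTS; apply: (measurableT_comp (f := muntz_profile lam \_ `]0, +oo[)).
    apply: (measurable_restrictT _ _).1 => //; apply: measurable_funTS.
    exact: continuous_measurable_fun.
  exact: measurable_funB.
- exact: measurable_stationary_transform.
- exists (riemann_steps (muntz_profile lam) u); split.
  + exact: step_in_riemann_steps.
  + exact: cvg_moving_average_steps cphi c0 bphi.
  + have E k := stationary_transform_error (@step_in_riemann_steps R (muntz_profile lam) u k).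
    rewrite (funext E).
    exact: cvg_lamperti_steps cphi c0 bphi.
Qed.

End lamperti_transform.

Lemma fourier_restrict (R : realType) (f : R -> R) (xi : R) :
  continuous f -> exp_decay f ->
  fourier (f \_ `]0, +oo[) xi = half_fourier f xi.
Proof.
move=> cf df; have [icos isin] := integrable_trig_decay xi cf df.
have sub : [set` `]0, +oo[] `<=` [set` `[(0 : R), +oo[].
  by move=> x; rewrite /= !in_itv/= !andbT; exact: ltW.
rewrite /fourier /half_fourier -(Rintegral_itv_obnd_cbnd (f := fun x => cos (xi * x) * f x));
  last exact: integrableS icos.
rewrite -(Rintegral_itv_obnd_cbnd (f := fun x => sin (xi * x) * f x)); last exact: integrableS isin.
by congr Complex; rewrite [RHS]Rintegral_mkcond; apply: eq_Rintegral => x _;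
   rewrite !patchE; case: ifP => //; rewrite mulr0.
Qed.

Theorem proposition3p1 (R : realType) (d : measure_display)
    (T : measurableType d) (P : probability T R)
    (n : nat) (n_gt0 : (0 < n)%N)
    (lam : 'I_n -> R) (lam_inj : injective lam)
    (lam_gt : forall j, - (1 / 2) < lam j)
    (B : R -> {RV P >-> R}) (hB : standard_brownian_motion B)
    (K : R -> T -> R) (hK : inner_integral_process B lam K)
    (W : R -> {RV P >-> R}) (hW : brownian_motion_on [set: R] W)
    (hWB : lamperti_brownian_motion B W) :
  exists eta : R -> R,
    [/\ forall x, x <= 0 -> eta x = 0,
        lebesgue_measure.-integrable [set: R] (EFin \o eta),
        forall xi : R,
          fourier eta xi =
          1 / ((1 / 2) -i* xi)%C * blaschke (fun j => lam j + 1 / 2) xi &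
        forall u : R,
          is_wiener_integral W `]-oo, u] (fun v => eta (u - v))
            (stationary_transform B K u)].
Proof.
have cphi := @continuous_muntz_profile R n lam.
have dphi := exp_decay_muntz_profile lam_gt.
(* The half-line is open because the kernel must vanish at 0, where the profile takes the value
   1. *)
exists (muntz_profile lam \_ `]0, +oo[); split.
- by move=> x x0; rewrite patchE ifF//; apply/negP; rewrite inE/= in_itv/= andbT ltNge x0.
- rewrite -restrict_EFin; apply/integrable_restrict => //; rewrite setTI.
  have [C [c [c0 bphi]]] := dphi.
  apply: integrableS (integrable_exp_bounded c0 _ bphi) => //.
    by move=> x; rewrite /= !in_itv/= !andbT; exact: ltW.
  exact: continuous_measurable_fun.
- move=> xi; rewrite fourier_restrict//.
  have z0 : ((1 / 2) -i* xi)%C != 0 :> R[i] by rewrite eq_complex/= gt_eqF//; lra.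
  by rewrite blaschkeE// -half_fourier_muntz_profile// mul1r mulKf.
- have [[_ _ _ B_dist] B0] := hB; move=> u.
  apply: is_wiener_integral_stationary => //.
  by move=> x y x0 y0; apply: B_dist; rewrite /= in_itv/= andbT.
Qed.
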